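(* The problem ''is a given composite state stable?'' is algorithmically decidable for CFSM protocols with the rational channel property whose communication graph has two nodes $0,1$ and two parallel edges $\alpha,\beta$, both from $0$ to $1$.
   Context: A CFSM protocol $\mathbf P$ has a finite directed communication graph $G=(N,E)$ (edge $\xi$ has tail $-\xi$, head $+\xi$), pairwise disjoint finite message sets $M_\xi$, and for each $j\in N$ a finite state machine $F_j=(K_j,\Sigma_j,T_j,h_j)$: finite state set $K_j$, initial state $h_j$, alphabet $\Sigma_j=\{+b: b\in M_\xi,\ j=+\xi\}\cup\{-b: b\in M_\xi,\ j=-\xi\}$, transitions $T_j\subseteq K_j\times\Sigma_j\times K_j$ ($+b$ = receive, $-b$ = send). A composite state is $S=(p_j:j\in N)$; a channel content is $C=(x_\xi:\xi\in E)$, $x_\xi\in M_\xi^*$; global states are pairs $(S,C)$; $C^0$ has all components empty; $S^0=(h_j:j\in N)$. A step: some machine $F_i$ takes $p_i\xrightarrow{-b}q_i$ with $b\in M_\beta$, $i=-\beta$, appending $b$ to the end of $x_\beta$; or takes $p_i\xrightarrow{+b}q_i$ with $b\in M_\beta$, $i=+\beta$, provided $x_\beta$ begins with $b$, removing it; all else unchanged. Reachable means reachable from $(S^0,C^0)$ by finitely many steps. A composite state $S$ is stable if $(S,C^0)$ is reachable. $\mathbf P$ has the rational channel property if for each composite state $S$ the set $\mathbf L(S)=\{C:(S,C)\text{ reachable}\}$ is a rational subset of the monoid $\prod_{\xi\in E}M_\xi^*$ (i.e. belongs to the smallest family containing finite sets and closed under union, componentwise product and Kleene star). *)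

(* Defs.v *)
From mathcomp Require Import all_boot.
Set Implicit Arguments. Unset Strict Implicit. Unset Printing Implicit Defensive.

(* Nodes are 0 .. nnodes-1, edges are indexed 0 .. size edges - 1,      *)
(* edge xi = (tail, head) = (-xi, +xi).  The message set M_xi is        *)
(* {0, .., nth 0 msize xi - 1}, tagged by the edge index, so the        *)
(* message sets are automatically pairwise disjoint.                    *)
(* Machine F_j has states {0, .., nth 0 nstates j - 1}, initial state   *)
(* nth 0 init j, and transitions nth [::] trans j, each of the form     *)
(* (p, (send, xi, b), q): send = true means the label -b (send b on xi),*)
(* send = false means the label +b (receive b from xi).                 *)
Record protocol := Protocol {
  nnodes : nat;
  edges : seq (nat * nat);
  msize : seq nat;
  nstates : seq nat;
  init : seq nat;
  trans : seq (seq (nat * (bool * nat * nat) * nat))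
}.

Definition trans_ok (P : protocol) (j : nat) (t : nat * (bool * nat * nat) * nat) : Prop :=
  let '(p, (snd, e, b), q) := t in
  [/\ p < nth 0 (nstates P) j, q < nth 0 (nstates P) j,
      e < size (edges P), b < nth 0 (msize P) e &
      (if snd then (nth (0,0) (edges P) e).1 = j
       else (nth (0,0) (edges P) e).2 = j)].

Definition wf (P : protocol) : Prop :=
  size (edges P) = size (msize P) /\
  all (fun e => (e.1 < nnodes P) && (e.2 < nnodes P)) (edges P) /\
  size (nstates P) = nnodes P /\
  size (init P) = nnodes P /\
  size (trans P) = nnodes P /\
  (forall j, j < nnodes P -> nth 0 (init P) j < nth 0 (nstates P) j) /\
  (forall j t, j < nnodes P -> t \in nth [::] (trans P) j -> trans_ok P j t).

Definition two_parallel_edges (P : protocol) : Prop :=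
  nnodes P = 2 /\ edges P = [:: (0, 1); (0, 1)].

(* composite state S = (p_j) ; channel content C = (x_xi) *)
Definition composite_state := seq nat.
Definition channel := seq (seq nat).
Definition gstate := (composite_state * channel)%type.

Definition valid_cs (P : protocol) (S : composite_state) : Prop :=
  size S = nnodes P /\ (forall j, j < nnodes P -> nth 0 S j < nth 0 (nstates P) j).

Definition valid_ch (P : protocol) (C : channel) : bool :=
  (size C == size (msize P)) &&
  all (fun mc => all (fun b => b < mc.1) mc.2) (zip (msize P) C).

Definition C0 (P : protocol) : channel := nseq (size (edges P)) [::].

Inductive step (P : protocol) : gstate -> gstate -> Prop :=
| step_send j p q e b (S : composite_state) (C : channel) :
    j < nnodes P -> (p, (true, e, b), q) \in nth [::] (trans P) j ->
    nth 0 S j = p ->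
    step P (S, C) (set_nth 0 S j q, set_nth [::] C e (rcons (nth [::] C e) b))
| step_recv j p q e b rest (S : composite_state) (C : channel) :
    j < nnodes P -> (p, (false, e, b), q) \in nth [::] (trans P) j ->
    nth 0 S j = p -> nth [::] C e = b :: rest ->
    step P (S, C) (set_nth 0 S j q, set_nth [::] C e rest).

Inductive reachable (P : protocol) : gstate -> Prop :=
| reach0 : reachable P (init P, C0 P)
| reachS g g' : reachable P g -> step P g g' -> reachable P g'.

Definition stable (P : protocol) (S : composite_state) : Prop :=
  reachable P (S, C0 P).

Inductive ratexp :=
| RFin of seq channel
| RUnion of ratexp & ratexp
| RProd of ratexp & ratexp
| RStar of ratexp.

Definition cmul (C1 C2 : channel) : channel := [seq x.1 ++ x.2 | x <- zip C1 C2].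

Fixpoint rsem (P : protocol) (r : ratexp) (C : channel) : Prop :=
  match r with
  | RFin s => C \in s /\ valid_ch P C
  | RUnion r1 r2 => rsem P r1 C \/ rsem P r2 C
  | RProd r1 r2 => exists C1 C2, [/\ rsem P r1 C1, rsem P r2 C2 & C = cmul C1 C2]
  | RStar r1 => exists l : seq channel,
      (forall C', C' \in l -> rsem P r1 C') /\ C = foldr cmul (C0 P) l
  end.

Definition rational_subset (P : protocol) (L : channel -> Prop) : Prop :=
  exists r : ratexp, forall C, L C <-> rsem P r C.

Definition L_of (P : protocol) (S : composite_state) : channel -> Prop :=
  fun C => reachable P (S, C).

Definition rational_channel_property (P : protocol) : Prop :=
  forall S, valid_cs P S -> rational_subset P (L_of P S).

(* Model of computation: register (Minsky counter) machines.            *)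
(* Registers indexed by nat, all 0 initially except register 0 = input. *)
Inductive rm_instr := Inc of nat | Dec of nat & nat.

Definition rm_config := (nat * seq nat)%type.

Definition rm_halted (prog : seq rm_instr) (c : rm_config) : bool := size prog <= c.1.

Definition rm_step (prog : seq rm_instr) (c : rm_config) : rm_config :=
  let: (pc, R) := c in
  if size prog <= pc then c else
  match nth (Inc 0) prog pc with
  | Inc r => (pc.+1, set_nth 0 R r (nth 0 R r).+1)
  | Dec r j => if nth 0 R r == 0 then (j, R) else (pc.+1, set_nth 0 R r (nth 0 R r).-1)
  end.

Definition rm_computes (prog : seq rm_instr) (x y : nat) : Prop :=
  exists n, let c := iter n (rm_step prog) (0, [:: x]) in
            rm_halted prog c /\ nth 0 c.2 0 = y.

Definition enc_protocol (P : protocol) :=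
  (nnodes P, edges P, msize P, nstates P, init P, trans P).

Definition code (P : protocol) (S : composite_state) : nat := pickle (enc_protocol P, S).

(* Main.v *)
(* The receiver may read every message as soon as it is available; then at any
   time at most one of the two channels is nonempty. So (p, q) is stable iff it
   is reachable through configurations with one empty channel. For a rational
   L(p, q), the set K(e, p, q) of the words x such that (p, q) is reachable with
   content x on channel e and nothing on the other one is a regular language.
   Hence instability of a composite state has a finite certificate: a finite
   quotient of the free monoid, given by the right and left actions rho and lam
   of the letters, with a subset of it for each (e, p, q) closed under the steps
   that keep one channel empty. Stability is witnessed by a run of the sender
   and a run of the receiver with equal projections. Both kinds of evidence are
   checked by primitive recursive functions, and a register machine searches for
   the first number that encodes evidence of either kind. *)
Require Import Defs.
From mathcomp Require Import all_boot zify.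
From Stdlib Require Import FunctionalExtensionality ClassicalEpsilon.
Set Implicit Arguments. Unset Strict Implicit. Unset Printing Implicit Defensive.

(** * Loop programs on register machines *)

Inductive cmd :=
| CSkip
| CInc of nat
| CSeq of cmd & cmd
| CLoop of nat & cmd.

Definition store := nat -> nat.

Definition upd (f : store) r v : store := fun x => if x == r then v else f x.

(* [CLoop r c] is "while r is nonzero, decrement r and run c". *)
Inductive exec : cmd -> store -> store -> Prop :=
| exec_skip f : exec CSkip f f
| exec_inc r f : exec (CInc r) f (upd f r (f r).+1)
| exec_seq c1 c2 f g h : exec c1 f g -> exec c2 g h -> exec (CSeq c1 c2) f h
| exec_loop0 r c f : f r = 0 -> exec (CLoop r c) f f
| exec_loopS r c f n g h :
    f r = n.+1 -> exec c (upd f r n) g -> exec (CLoop r c) g h ->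
    exec (CLoop r c) f h.

(* Register r of a command is register 2r of the machine; register 1 is never
   written and hence stays 0, so that [Dec 1 k] is an unconditional jump. *)
Fixpoint assemble (c : cmd) (k : nat) : seq rm_instr :=
  match c with
  | CSkip => [::]
  | CInc r => [:: Inc r.*2]
  | CSeq c1 c2 =>
      let s := assemble c1 k in s ++ assemble c2 (k + size s)
  | CLoop r c1 =>
      let s := assemble c1 k.+1 in
      Dec r.*2 (k + (size s).+2) :: rcons s (Dec 1 k)
  end.

Definition represents (R : seq nat) (f : store) :=
  nth 0 R 1 = 0 /\ forall r, nth 0 R r.*2 = f r.

Lemma represents_upd R f r v :
  represents R f -> represents (set_nth 0 R r.*2 v) (upd f r v).
Proof.
move=> [R1 Rf]; split=> [|x]; rewrite nth_set_nth /=; first by case: eqP => //; lia.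
by rewrite /upd Rf; do 2![case: eqP => //]; lia.
Qed.

Definition code_at (prog : seq rm_instr) k s :=
  exists p1 p2, prog = p1 ++ s ++ p2 /\ size p1 = k.

Lemma code_at_catl prog k s1 s2 : code_at prog k (s1 ++ s2) -> code_at prog k s1.
Proof. by case=> p1 [p2] [-> <-]; exists p1, (s2 ++ p2); rewrite -catA. Qed.

Lemma code_at_catr prog k s1 s2 :
  code_at prog k (s1 ++ s2) -> code_at prog (k + size s1) s2.
Proof.
by case=> p1 [p2] [-> <-]; exists (p1 ++ s1), p2; rewrite -!catA size_cat.
Qed.

Lemma code_at_nth prog k i s :
  code_at prog k (i :: s) -> k < size prog /\ nth (Inc 0) prog k = i.
Proof.
case=> p1 [p2] [-> <-]; rewrite nth_cat ltnn subnn /=; split=> //.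
by rewrite size_cat /=; lia.
Qed.

Definition rm_reaches prog c c' := exists n, iter n (rm_step prog) c = c'.

Lemma rm_reaches_trans prog c1 c2 c3 :
  rm_reaches prog c1 c2 -> rm_reaches prog c2 c3 -> rm_reaches prog c1 c3.
Proof. by case=> n <- [m <-]; exists (m + n); rewrite iterD. Qed.

Lemma rm_reaches1 prog c : rm_reaches prog c (rm_step prog c).
Proof. by exists 1. Qed.

(** The induction is on the execution, not on the command: after one round of a loop, the jump
    [Dec 1 k] returns to address [k], where the rest of the execution concerns the same code. *)
Lemma assemble_correct c f g prog k R :
  exec c f g -> code_at prog k (assemble c k) -> represents R f ->
  exists R', rm_reaches prog (k, R) (k + size (assemble c k), R') /\
             represents R' g.
Proof.
move=> cfg; elim: cfg k R => {c f g}
  [f|r f|c1 c2 f g h _ IH1 _ IH2|r c f fr0|r c f n g h frS _ IHc _ IHl] k R /= cat Rf.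
- by exists R; split=> //; exists 0; rewrite addn0.
- have [lk nk] := code_at_nth cat.
  exists (set_nth 0 R r.*2 (nth 0 R r.*2).+1); split; last first.
    by rewrite Rf.2; apply: represents_upd.
  by exists 1; rewrite /= leqNgt lk nk addn1.
- have [R1 [r1 R1g]] := IH1 _ _ (code_at_catl cat) Rf.
  have [R2 [r2 R2h]] := IH2 _ _ (code_at_catr cat) R1g.
  by exists R2; split=> //; rewrite size_cat addnA; apply: rm_reaches_trans r2.
- have [lk nk] := code_at_nth cat.
  by exists R; split=> //; exists 1; rewrite /= leqNgt lk nk Rf.2 fr0 eqxx size_rcons.
- have [lk nk] := code_at_nth cat.
  have cat2 : code_at prog k.+1 (rcons (assemble c k.+1) (Dec 1 k)).
    by have := @code_at_catr prog k [:: _] _ cat; rewrite addn1.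
  rewrite -cats1 in cat2.
  have [R1 [r1 R1g]] := IHc _ _ (code_at_catl cat2) (represents_upd r n Rf).
  have [R2 [r2 R2h]] := IHl _ _ cat R1g.
  exists R2; split=> //.
  apply: rm_reaches_trans (rm_reaches1 _ _) _.
  rewrite /= leqNgt lk nk Rf.2 frS /=.
  apply: rm_reaches_trans r1 _.
  apply: rm_reaches_trans (rm_reaches1 _ _) _.
  have [lk1 nk1] := code_at_nth (code_at_catr cat2).
  by rewrite /= leqNgt lk1 nk1 R1g.1 eqxx.
Qed.

(** [J i] is the store after [i] rounds. The body starts after the decrement of [r], so in round [i]
    it sees [n - i.+1] there. *)
Lemma exec_inv r c (J : nat -> store) n :
  (forall i, i <= n -> J i r = n - i) ->
  (forall i, i < n -> exec c (upd (J i) r (n - i.+1)) (J i.+1)) ->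
  exec (CLoop r c) (J 0) (J n).
Proof.
move=> Jr Jc.
have H m : forall i, i + m = n -> exec (CLoop r c) (J i) (J n).
  elim: m => [|m IH] i imn; first by rewrite -imn addn0; apply: exec_loop0; rewrite Jr; lia.
  have lin : i < n by lia.
  apply: (@exec_loopS r c (J i) (n - i.+1) (J i.+1)) (Jc _ lin) (IH _ _); last by lia.
  by rewrite Jr; lia.
exact: (H n).
Qed.

Lemma exec_ext c f f' g g' : exec c f g -> f =1 f' -> g =1 g' -> exec c f' g'.
Proof. by move=> cfg /functional_extensionality <- /functional_extensionality <-. Qed.

Ltac upd_tac :=
  rewrite /upd ?eqxx; repeat (case: eqP => //= ?; subst; rewrite ?eqxx); lia.

Lemma exec_move s d f : s != d ->
  exec (CLoop s (CInc d)) f (upd (upd f s 0) d (f d + f s)).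
Proof.
move=> sd; pose J i := upd (upd f s (f s - i)) d (f d + i).
apply: (exec_ext (f := J 0) (g := J (f s))); try by move=> x; rewrite /J; upd_tac.
apply: exec_inv => i lei; first by rewrite /J; upd_tac.
by apply: exec_ext (exec_inc d _) _ _ => // x; rewrite /J; upd_tac.
Qed.

Lemma exec_clear s f : exec (CLoop s CSkip) f (upd f s 0).
Proof.
pose J i := upd f s (f s - i).
apply: (exec_ext (f := J 0) (g := J (f s))); try by move=> x; rewrite /J; upd_tac.
apply: exec_inv => i lei; first by rewrite /J; upd_tac.
by apply: exec_ext (exec_skip _) _ _ => // x; rewrite /J; upd_tac.
Qed.

(** * Primitive recursive terms and their compilation into loop programs *)

Inductive term :=
| TVar of nat
| TZero
| TSucc of term
| TLet of term & term
| TShift of term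
| TRec of term & term & term.

(** [TLet] and [TShift] together replace composition: arguments are pushed one at a time, each
    evaluated with the earlier pushes dropped, so that no arities have to be tracked. *)
Fixpoint eval (t : term) (e : seq nat) : nat :=
  match t with
  | TVar i => nth 0 e i
  | TZero => 0
  | TSucc t1 => (eval t1 e).+1
  | TLet t1 t2 => eval t2 (eval t1 e :: e)
  | TShift t1 => eval t1 (behead e)
  | TRec n a g =>
      iteri (eval n e) (fun i acc => eval g [:: acc, i & e]) (eval a e)
  end.

(* Adds the value of t to register d, where rho lists the registers holding the
   environment; the registers from k on are scratch, initially and finally 0. *)
Fixpoint compile (t : term) (rho : seq nat) (d k : nat) : cmd :=
  match t with
  | TVar i =>
      if i < size rho then
        CSeq (CLoop (nth 0 rho i) (CSeq (CInc d) (CInc k)))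
             (CLoop k (CInc (nth 0 rho i)))
      else CSkip
  | TZero => CSkip
  | TSucc t1 => CSeq (compile t1 rho d k) (CInc d)
  | TLet t1 t2 =>
      CSeq (compile t1 rho k k.+1)
        (CSeq (compile t2 (k :: rho) d k.+1) (CLoop k CSkip))
  | TShift t1 => compile t1 (behead rho) d k
  | TRec n a g =>
      CSeq (compile n rho k k.+1)
      (CSeq (compile a rho k.+2 k.+3)
      (CSeq (CLoop k
        (CSeq (compile g [:: k.+2, k.+1 & rho] k.+3 k.+4)
        (CSeq (CLoop k.+2 CSkip)
        (CSeq (CLoop k.+3 (CInc k.+2)) (CInc k.+1)))))
      (CSeq (CLoop k.+2 (CInc d)) (CLoop k.+1 CSkip))))
  end.

(** A loop consumes its counter, so [s] is moved to both [d] and the scratch register [k], then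
    restored from [k]. *)
Lemma exec_copy s d k f : s != d -> s != k -> d != k -> f k = 0 ->
  exec (CSeq (CLoop s (CSeq (CInc d) (CInc k))) (CLoop k (CInc s)))
    f (upd f d (f d + f s)).
Proof.
move=> sd sk dk fk; pose J i := upd (upd (upd f s (f s - i)) d (f d + i)) k i.
apply: (@exec_seq _ _ _ (J (f s))); last first.
  have ks : k != s by rewrite eq_sym.
  by apply: exec_ext (exec_move _ ks) _ _ => // x; rewrite /J; upd_tac.
apply: (exec_ext (f := J 0) (g := J (f s))) => //; last first.
  by move=> x; rewrite /J; upd_tac.
apply: exec_inv => i lei; first by rewrite /J; upd_tac.
apply: exec_seq (exec_inc _ _) _.
by apply: exec_ext (exec_inc _ _) _ _ => // x; rewrite /J; upd_tac.
Qed.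

Lemma map_upd f r v rho : r \notin rho -> map (upd f r v) rho = map f rho.
Proof.
move=> rrho; apply/eq_in_map => x xrho; rewrite /upd.
by case: eqP => // xr; rewrite -xr xrho in rrho.
Qed.

(** Register [k] counts the remaining rounds, [k.+1] holds the index, [k.+2] the accumulator, and
    [k.+3] receives the next accumulator before it replaces the old one. *)
Lemma exec_rec cn ca cg d k f N (F : nat -> nat) :
  d < k -> (forall r, k <= r -> f r = 0) ->
  exec cn f (upd f k N) ->
  exec ca (upd f k N) (upd (upd f k N) k.+2 (F 0)) ->
  (forall i, i < N ->
    let g := upd (upd (upd f k (N - i.+1)) k.+1 i) k.+2 (F i) in
    exec cg g (upd g k.+3 (F i.+1))) ->
  exec (CSeq cn (CSeq ca (CSeq (CLoop k
          (CSeq cg (CSeq (CLoop k.+2 CSkip)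
                   (CSeq (CLoop k.+3 (CInc k.+2)) (CInc k.+1)))))
        (CSeq (CLoop k.+2 (CInc d)) (CLoop k.+1 CSkip)))))
    f (upd f d (f d + F N)).
Proof.
move=> dk fk En Ea Eg.
have [fk0 [fk1 [fk2 fk3]]] : f k = 0 /\ f k.+1 = 0 /\ f k.+2 = 0 /\ f k.+3 = 0.
  by do !split; apply: fk; lia.
pose J i := upd (upd (upd f k (N - i)) k.+1 i) k.+2 (F i).
apply: exec_seq En _; apply: exec_seq Ea _.
apply: (@exec_seq _ _ _ (J N)); last first.
  apply: exec_seq; first by apply: exec_move; lia.
  apply: exec_ext (exec_clear _ _) _ _ => // x.
  by rewrite /J; move: (F) => F'; clear -dk fk0 fk1 fk2 fk3; upd_tac.
apply: (exec_ext (f := J 0) (g := J N)) => //; last first.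
  by move=> x; rewrite /J; move: (F) => F'; clear -dk fk0 fk1 fk2 fk3; upd_tac.
apply: exec_inv => i lei.
  by rewrite /J; move: (F) => F'; clear; upd_tac.
pose g := upd (upd (upd f k (N - i.+1)) k.+1 i) k.+2 (F i).
apply: (exec_ext (f := g) (g := J i.+1)) => //; last first.
  by move=> x; rewrite /J /g; move: (F) => F'; clear; upd_tac.
apply: exec_seq (Eg _ lei) _; apply: exec_seq (exec_clear _ _) _.
apply: exec_seq; first by apply: exec_move; lia.
apply: exec_ext (exec_inc _ _) _ _ => // x.
rewrite /J /g; move: (F i) (F i.+1) => u v; clear -dk fk0 fk1 fk2 fk3.
by upd_tac.
Qed.

(** The environment lies below [k] and avoids [d], so neither scratch work nor the result disturbs
    values that are still to be read. Scratch registers must start at 0 because compiled code adds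
    to its target. *)
Lemma compile_correct t rho d k f :
  all (ltn^~ k) rho -> d < k -> d \notin rho -> (forall r, k <= r -> f r = 0) ->
  exec (compile t rho d k) f (upd f d (f d + eval t (map f rho))).
Proof.
elim: t rho d k f => [i||t IH|t1 IH1 t2 IH2|t IH|n IHn a IHa g IHg]
  rho d k f rhok dk drho fk /=.
- case: ltnP => isz; last first.
    rewrite nth_default ?size_map //.
    by apply: exec_ext (exec_skip _) _ _ => // x; upd_tac.
  rewrite (nth_map 0) //; have irho := mem_nth 0 isz.
  have lik := allP rhok _ irho; rewrite /= in lik.
  apply: exec_copy; rewrite ?fk //; try lia.
  by apply: contraNneq drho => <-.
- by apply: exec_ext (exec_skip _) _ _ => // x; upd_tac.
- apply: exec_seq; first exact: IH.
  by apply: exec_ext (exec_inc _ _) _ _ => // x; upd_tac.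
- have krho : k \notin rho by apply/negP => /(allP rhok) /=; lia.
  have rhok1 : all (ltn^~ k.+1) rho by apply: sub_all rhok => x /=; lia.
  apply: exec_seq; first by apply: IH1 => // r kr; apply: fk; lia.
  apply: exec_seq; first apply: IH2.
  + by rewrite /= ltnSn.
  + by lia.
  + by rewrite inE (negbTE drho); lia.
  + by move=> r kr; rewrite /upd; case: eqP => ?; [lia | apply: fk; lia].
  apply: exec_ext (exec_clear _ _) _ _ => //= x.
  rewrite map_upd // [upd f k _ k]/upd eqxx.
  have fk0 := fk k (leqnn k); rewrite fk0 add0n.
  by upd_tac.
- have brhok : all (ltn^~ k) (behead rho).
    by case: rho rhok {drho} => //= ? ? /andP[].
  have dbrho : d \notin behead rho.
    by case: rho drho {rhok brhok} => //= ? ?; rewrite inE negb_or => /andP[].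
  by rewrite behead_map; apply: IH.
- have krho j : k + j \notin rho by apply/negP => /(allP rhok) /=; lia.
  have rhokj j : all (ltn^~ (k + j)) rho by apply: sub_all rhok => x /=; lia.
  have fk' j r : k + j <= r -> f r = 0 by move=> kr; apply: fk; lia.
  set e := map f rho.
  pose F i := iteri i (fun i acc => eval g [:: acc, i & e]) (eval a e).
  have fk0 := fk k (leqnn k).
  apply: (exec_rec (F := F)) => //.
  + apply: exec_ext (IHn rho k k.+1 f _ _ _ _) _ _ => //.
    * by rewrite -addn1.
    * by rewrite -[k]addn0.
    * by move=> r; rewrite -addn1; apply: fk'.
    * by rewrite fk0.
  + have := IHa rho k.+2 k.+3 (upd f k (eval n e)).
    rewrite map_upd; last by rewrite -[k]addn0.
    have -> : upd f k (eval n e) k.+2 = 0 by rewrite /upd; case: eqP => ?; [lia | apply: fk; lia].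
    apply=> //; [by rewrite -addn3 | by rewrite -addn2 | move=> r kr].
    by rewrite /upd; case: eqP => ?; [lia | apply: fk; lia].
  + move=> i lei h.
    have := IHg [:: k.+2, k.+1 & rho] k.+3 k.+4 h.
    have -> : h k.+3 = 0 by rewrite /h /upd; do 3![case: eqP => ?; first lia]; apply: fk; lia.
    have -> : map h [:: k.+2, k.+1 & rho] = [:: F i, i & e].
      have k0 := krho 0; have k1 := krho 1; have k2 := krho 2.
      rewrite ?addn0 ?addn1 ?addn2 in k0 k1 k2.
      have hrho : map h rho = e by rewrite /h !map_upd.
      have h2 : h k.+2 = F i by rewrite /h /upd eqxx.
      have h1 : h k.+1 = i by rewrite /h /upd eqxx; case: eqP => // ?; lia.
      by rewrite /= hrho h2 h1.
    apply=> //.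
    * by rewrite /= -(addn4 k) rhokj; lia.
    * by rewrite !inE -(addn3 k) (negbTE (krho _)); lia.
    * by move=> r kr; rewrite /h /upd; do 3![case: eqP => ?; first lia]; apply: fk; lia.
Qed.

(** * Primitive recursive functions *)

Definition PR (f : seq nat -> nat) := exists t, eval t =1 f.

(** Unbounded search as a single loop: register 0 keeps the input, 1 the candidate, 2 the flag for
    going on, 3 the answer. The candidate is incremented after every test, also the successful one,
    which explains the [.-1] in the hypothesis on [ans]. *)
Lemma rm_search (found : nat -> nat -> bool) (ans : nat -> nat -> nat) :
  PR (fun e => ~~ found (nth 0 e 0) (nth 0 e 1)) ->
  PR (fun e => ans (nth 0 e 0) (nth 0 e 1).-1) ->
  exists prog, forall x n, found x n -> (forall m, m < n -> ~~ found x m) ->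
    rm_computes prog x (ans x n).
Proof.
move=> [tn tnE] [ta taE].
pose body := CSeq (compile tn [:: 0; 1] 2 4) (CInc 1).
pose c := CSeq (CInc 2) (CSeq (CLoop 2 body)
  (CSeq (compile ta [:: 0; 1] 3 4) (CSeq (CLoop 0 CSkip) (CLoop 3 (CInc 0))))).
exists (assemble c 0) => x n fn nfm.
pose f0 r := if r == 0 then x else 0.
pose st m b := upd (upd f0 1 m) 2 b.
have stbig m b r : 4 <= r -> st m b r = 0.
  by rewrite /st /f0 => r4; upd_tac.
(* Induction on the number [k] of failing candidates from [m] up to the first success [n]. *)
have loop k : forall m, m + k = n -> exec (CLoop 2 body) (st m 1) (st n.+1 0).
  elim: k => [|k IH] m mkn.
    rewrite addn0 in mkn; subst m.
    apply: (@exec_loopS _ _ _ 0 (st n.+1 0)); [by rewrite /st; upd_tac | |]; last first.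
      by apply: exec_loop0; rewrite /st; upd_tac.
    apply: (@exec_ext _ (st n 0) _ (st n.+1 0)) => //; last first.
      by move=> r; rewrite /st; upd_tac.
    apply: exec_seq.
      by apply: (@compile_correct tn [:: 0; 1] 2 4 (st n 0)) => // r; apply: stbig.
    rewrite tnE /= [st n 0 0]/st /= [st n 0 1]/st /= /f0 /= fn /=.
    by apply: exec_ext (exec_inc _ _) _ _ => // r; rewrite /st; upd_tac.
  apply: (@exec_loopS _ _ _ 0 (st m.+1 1)); [by rewrite /st; upd_tac | |]; last first.
    by apply: IH; rewrite addSnnS.
  apply: (@exec_ext _ (st m 0) _ (st m.+1 1)) => //; last first.
    by move=> r; rewrite /st; upd_tac.
  apply: exec_seq.
    by apply: (@compile_correct tn [:: 0; 1] 2 4 (st m 0)) => // r; apply: stbig.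
  have nfx : ~~ found x m by apply: nfm; lia.
  rewrite tnE /= [st m 0 0]/st /= [st m 0 1]/st /= /f0 /= nfx.
  by apply: exec_ext (exec_inc _ _) _ _ => // r; rewrite /st; upd_tac.
have [g [ecg g0]] : exists g, exec c f0 g /\ g 0 = ans x n.
  eexists; split.
    apply: exec_seq.
      apply: (@exec_ext _ f0 f0 _ (st 0 1)) (exec_inc _ _) _ _ => //.
      by move=> r; rewrite /st /f0; upd_tac.
    apply: exec_seq; first exact: (loop n 0).
    apply: exec_seq.
      by apply: (@compile_correct ta [:: 0; 1] 3 4 (st n.+1 0)) => // r; apply: stbig.
    by apply: exec_seq; [apply: exec_clear | apply: exec_move].
  by rewrite taE /upd /st /f0.
have cat : code_at (assemble c 0) 0 (assemble c 0).
  by exists [::], [::]; rewrite cats0.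
have rep : represents [:: x] f0 by split=> // -[|r] //; rewrite /f0 /= nth_nil.
have [R' [[k kE] [_ R'g]]] := assemble_correct ecg cat rep.
exists k; rewrite kE add0n /rm_halted leqnn; split=> //.
by rewrite -g0 -R'g.
Qed.

Lemma pr_ext f g : PR f -> f =1 g -> PR g.
Proof. by case=> t tf fg; exists t => e; rewrite tf. Qed.

Lemma pr_nth i : PR (fun e => nth 0 e i).
Proof. by exists (TVar i). Qed.

Lemma pr_S f : PR f -> PR (fun e => (f e).+1).
Proof. by case=> t tf; exists (TSucc t) => e /=; rewrite tf. Qed.

Lemma pr_const c : PR (fun=> c).
Proof. by elim: c => [|c IH]; [exists TZero | apply: pr_S]. Qed.

Lemma pr_let f g : PR f -> PR g -> PR (fun e => g (f e :: e)).
Proof. by case=> t tf [u ug]; exists (TLet t u) => e /=; rewrite tf ug. Qed.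

Lemma pr_shift f : PR f -> PR (fun e => f (behead e)).
Proof. by case=> t tf; exists (TShift t) => e /=; rewrite tf. Qed.

Lemma pr_rec n a (g : nat -> nat -> seq nat -> nat) :
  PR n -> PR a -> PR (fun e => g (nth 0 e 1) (nth 0 e 0) (behead (behead e))) ->
  PR (fun e => iteri (n e) (fun i acc => g i acc e) (a e)).
Proof.
case=> tn tnE [ta taE] [tg tgE]; exists (TRec tn ta tg) => e /=.
rewrite tnE taE; elim: (n e) => //= k ->.
by rewrite tgE.
Qed.

Lemma pr_app1 F f :
  PR (fun e => F (nth 0 e 0)) -> PR f -> PR (fun e => F (f e)).
Proof. by move=> pF pf; apply: (pr_let pf pF). Qed.

(** It suffices to treat [F] on variables. This matters when [F] uses its arguments inside a
    recursion, where the environment has grown. *)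
Lemma pr_app2 F f g :
  PR (fun e => F (nth 0 e 0) (nth 0 e 1)) -> PR f -> PR g ->
  PR (fun e => F (f e) (g e)).
Proof. by move=> pF pf pg; apply: (pr_let pg (pr_let (pr_shift pf) pF)). Qed.

Lemma pr_app4 F f g h k :
  PR (fun e => F (nth 0 e 0) (nth 0 e 1) (nth 0 e 2) (nth 0 e 3)) ->
  PR f -> PR g -> PR h -> PR k -> PR (fun e => F (f e) (g e) (h e) (k e)).
Proof.
move=> pF pf pg ph pk.
by apply: (pr_let pk (pr_let (pr_shift ph) (pr_let (pr_shift (pr_shift pg))
            (pr_let (pr_shift (pr_shift (pr_shift pf))) pF)))).
Qed.

Lemma pr_app6 F f g h k l m :
  PR (fun e => F (nth 0 e 0) (nth 0 e 1) (nth 0 e 2) (nth 0 e 3) (nth 0 e 4) (nth 0 e 5)) ->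
  PR f -> PR g -> PR h -> PR k -> PR l -> PR m ->
  PR (fun e => F (f e) (g e) (h e) (k e) (l e) (m e)).
Proof.
move=> pF pf pg ph pk pl pm.
have s2 := fun f pf => pr_shift (@pr_shift f pf).
have s4 := fun f pf => s2 _ (s2 f pf).
by apply: (pr_let pm (pr_let (pr_shift pl) (pr_let (s2 _ pk) (pr_let (s2 _ (pr_shift ph))
  (pr_let (s4 _ pg) (pr_let (s4 _ (pr_shift pf)) pF)))))).
Qed.

Create HintDb pr discriminated.
#[local] Hint Constants Opaque : pr.
#[local] Hint Variables Opaque : pr.

Ltac pr_var :=
  cbv beta;
  lazymatch goal with
  | |- PR (fun e => nth 0 _ ?i) =>
      refine (@pr_ext _ _ (pr_nth _) _);
      let e := fresh "e" in intro e; rewrite ?nth_behead; reflexivity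
  end.

#[local] Hint Extern 0 (PR _) => pr_var : pr.
#[local] Hint Resolve pr_const pr_S : pr.

Ltac pr := eauto 1000 with pr nocore.

Lemma pr_add f g : PR f -> PR g -> PR (fun e => f e + g e).
Proof.
move=> pf pg; apply: (pr_ext (f := fun e => iteri (g e) (fun _ acc => acc.+1) (f e))).
  by apply: (pr_rec (g := fun _ acc _ => acc.+1)) => //; pr.
by move=> e; elim: (g e) => [|n /= ->]; rewrite ?addn0 ?addnS.
Qed.

Lemma pr_pred f : PR f -> PR (fun e => (f e).-1).
Proof.
move=> pf; apply: (pr_ext (f := fun e => iteri (f e) (fun i _ => i) 0)).
  by apply: (pr_rec (g := fun i _ _ => i)) => //; pr.
by move=> e; case: (f e).
Qed.
#[local] Hint Resolve pr_add pr_pred : pr.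

Lemma pr_sub f g : PR f -> PR g -> PR (fun e => f e - g e).
Proof.
move=> pf pg; apply: (pr_ext (f := fun e => iteri (g e) (fun _ acc => acc.-1) (f e))).
  by apply: (pr_rec (g := fun _ acc _ => acc.-1)) => //; pr.
by move=> e; elim: (g e) => [|n /= ->]; rewrite ?subn0 ?subnS.
Qed.

Lemma pr_mul f g : PR f -> PR g -> PR (fun e => f e * g e).
Proof.
move=> pf pg; apply: (pr_app2 (F := muln)) => //.
apply: (pr_ext (f := fun e => iteri (nth 0 e 1) (fun _ acc => acc + nth 0 e 0) 0)).
  by apply: (pr_rec (g := fun _ acc e => acc + nth 0 e 0)); pr.
by move=> e; elim: (nth 0 e 1) => [|n /= ->]; rewrite ?muln0 // mulnSr.
Qed.

Lemma pr_exp2 f : PR f -> PR (fun e => 2 ^ f e).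
Proof.
move=> pf; apply: (pr_ext (f := fun e => iteri (f e) (fun _ acc => acc + acc) 1)).
  by apply: (pr_rec (g := fun _ acc _ => acc + acc)) => //; pr.
by move=> e; elim: (f e) => [|n /= ->] //; rewrite expnS mul2n addnn.
Qed.

(** Predicates are handled as functions with values 0 and 1, through the coercion of booleans to
    numbers. *)
Lemma pr_eq0 f : PR f -> PR (fun e => f e == 0).
Proof.
move=> pf; apply: (pr_ext (f := fun e => 1 - f e)); last by move=> e; case: (f e).
by apply: pr_sub => //; pr.
Qed.
#[local] Hint Resolve pr_sub pr_mul pr_exp2 : pr.

Lemma pr_eq f g : PR f -> PR g -> PR (fun e => f e == g e).
Proof.
move=> pf pg; apply: (pr_ext (f := fun e => (f e - g e) + (g e - f e) == 0)).
  by apply: pr_eq0; pr.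
by move=> e; congr nat_of_bool; lia.
Qed.

Lemma pr_leq f g : PR f -> PR g -> PR (fun e => f e <= g e).
Proof. by move=> pf pg; apply: pr_eq0; pr. Qed.

Lemma pr_andb (f g : seq nat -> bool) : PR f -> PR g -> PR (fun e => f e && g e).
Proof.
move=> pf pg; apply: (pr_ext (f := fun e => f e * g e)); first by pr.
by move=> e; rewrite mulnb.
Qed.

Lemma pr_negb (f : seq nat -> bool) : PR f -> PR (fun e => ~~ f e).
Proof.
move=> pf; apply: (pr_ext (f := fun e => 1 - f e)); first by pr.
by move=> e; case: (f e).
Qed.
#[local] Hint Resolve pr_eq pr_leq pr_andb pr_negb : pr.

Lemma pr_orb (f g : seq nat -> bool) : PR f -> PR g -> PR (fun e => f e || g e).
Proof.
move=> pf pg; apply: (pr_ext (f := fun e => ~~ (~~ f e && ~~ g e))); first by pr.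
by move=> e; rewrite negb_and !negbK.
Qed.

Lemma pr_implyb (f g : seq nat -> bool) : PR f -> PR g -> PR (fun e => f e ==> g e).
Proof.
move=> pf pg; apply: (pr_ext (f := fun e => ~~ (f e && ~~ g e))); first by pr.
by move=> e; rewrite negb_and negbK implybE.
Qed.

Lemma pr_if (b : seq nat -> bool) f g :
  PR b -> PR f -> PR g -> PR (fun e => if b e then f e else g e).
Proof.
move=> pb pf pg; apply: (pr_ext (f := fun e => b e * f e + ~~ b e * g e)); first by pr.
by move=> e; case: (b e) => /=; lia.
Qed.
#[local] Hint Resolve pr_orb pr_implyb pr_if : pr.

(** * Bounded quantifiers and bounded sums *)

Definition all_lt n (P : pred nat) := all P (iota 0 n).
Definition sum_lt n (F : nat -> nat) := sumn (map F (iota 0 n)).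

Lemma all_ltP n (P : pred nat) : reflect (forall i, i < n -> P i) (all_lt n P).
Proof.
apply: (iffP allP) => H i; first by move=> lin; apply: H; rewrite mem_iota.
by rewrite mem_iota => /andP[_]; apply: H.
Qed.

Lemma pr_all_lt n (P : seq nat -> nat -> bool) :
  PR n -> PR (fun e => P (behead e) (nth 0 e 0)) -> PR (fun e => all_lt (n e) (P e)).
Proof.
move=> pn pP.
apply: (pr_ext (f := fun e => iteri (n e) (fun i acc => acc * P e i) 1)).
  apply: (pr_rec (g := fun i acc e => acc * P e i)) => //; first by pr.
  apply: pr_mul; first by pr.
  (* The recursion puts the accumulator in front of the index; the shift removes it, leaving the
     index as variable 0. *)
  by apply: (pr_ext (pr_shift pP)) => e; rewrite nth_behead.
move=> e; rewrite /all_lt; elim: (n e) => // k IH.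
by rewrite -[in RHS]addn1 iotaD all_cat /= IH andbT mulnb.
Qed.

Lemma pr_sum_lt n (F : seq nat -> nat -> nat) :
  PR n -> PR (fun e => F (behead e) (nth 0 e 0)) -> PR (fun e => sum_lt (n e) (F e)).
Proof.
move=> pn pF.
apply: (pr_ext (f := fun e => iteri (n e) (fun i acc => acc + F e i) 0)).
  apply: (pr_rec (g := fun i acc e => acc + F e i)) => //; first by pr.
  apply: pr_add; first by pr.
  by apply: (pr_ext (pr_shift pF)) => e; rewrite nth_behead.
move=> e; rewrite /sum_lt; elim: (n e) => // k IH.
by rewrite -[in RHS]addn1 iotaD map_cat sumn_cat /= IH addn0.
Qed.

Definition ex_lt n (P : pred nat) := ~~ all_lt n (predC P).

Lemma ex_ltP n (P : pred nat) : reflect (exists2 i, i < n & P i) (ex_lt n P).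
Proof.
rewrite /ex_lt -has_predC; apply: (iffP hasP) => -[i].
  by rewrite mem_iota /= negbK => lin Pi; exists i.
by move=> lin Pi; exists i; rewrite ?mem_iota //= negbK.
Qed.

Lemma pr_ex_lt n (P : seq nat -> nat -> bool) :
  PR n -> PR (fun e => P (behead e) (nth 0 e 0)) -> PR (fun e => ex_lt (n e) (P e)).
Proof.
move=> pn pP; apply: pr_negb.
by apply: (pr_all_lt (P := fun e => predC (P e))) => //; apply: pr_negb.
Qed.
#[local] Hint Resolve pr_all_lt pr_sum_lt pr_ex_lt : pr.

(* A natural number is read as the list it encodes under [CodeSeq.code]. *)
Definition consc (x l : nat) := 2 ^ x * l.*2.+1.
(** Since [consc] is injective, at most one pair contributes to the sum, and the bounds suffice
    because both parts of a cell are smaller than the cell. The code 0 of the empty list has head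
    and tail 0. *)
Definition hdc l := sum_lt l (fun h => sum_lt l (fun t => (consc h t == l) * h)).
Definition tlc l := sum_lt l (fun h => sum_lt l (fun t => (consc h t == l) * t)).
Definition dropc l i := iter i tlc l.
Definition nthc l i := hdc (dropc l i).

Lemma consc_code x s : consc x (CodeSeq.code s) = CodeSeq.code (x :: s).
Proof. by []. Qed.

Lemma consc_inj x y k l : consc x k = consc y l -> x = y /\ k = l.
Proof.
rewrite -(CodeSeq.decodeK k) -(CodeSeq.decodeK l) !consc_code.
by move/(can_inj CodeSeq.codeK) => [-> ->].
Qed.

Lemma consc_gtl x l : x < consc x l.
Proof.
by rewrite /consc -[x.+1]muln1 leq_mul // ltn_expl.
Qed.

Lemma consc_gtr x l : l < consc x l.
Proof.
rewrite /consc -[l.+1]mul1n leq_mul ?expn_gt0 //; lia.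
Qed.

Lemma sum_lt_eq0 n F : (forall i, i < n -> F i = 0) -> sum_lt n F = 0.
Proof.
move=> F0; rewrite /sum_lt sumnE big_map big_seq big1 // => i.
by rewrite mem_iota; apply: F0.
Qed.

Lemma sum_lt1 n F i : i < n -> (forall j, j != i -> F j = 0) -> sum_lt n F = F i.
Proof.
move=> lin F0; rewrite /sum_lt sumnE big_map.
rewrite (bigD1_seq i) ?mem_iota ?iota_uniq //= big1 ?addn0 //.
Qed.

Lemma sum_lt_cons x l (F : nat -> nat -> nat) :
  let m := consc x l in
  sum_lt m (fun h => sum_lt m (fun t => (consc h t == m) * F h t)) = F x l.
Proof.
move=> m; rewrite (@sum_lt1 _ _ x) ?consc_gtl //; last first.
  move=> j jx; apply: sum_lt_eq0 => i _; case: eqP => // /consc_inj[jx' _].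
  by rewrite jx' eqxx in jx.
rewrite (@sum_lt1 _ _ l) ?consc_gtr ?eqxx ?mul1n // => j jl.
by case: eqP => // /consc_inj[_ jl']; rewrite jl' eqxx in jl.
Qed.

Lemma hdc_cons x l : hdc (consc x l) = x.
Proof. exact: (sum_lt_cons _ _ (fun h _ => h)). Qed.

Lemma tlc_cons x l : tlc (consc x l) = l.
Proof. exact: (sum_lt_cons _ _ (fun _ t => t)). Qed.

Lemma hdc_code s : hdc (CodeSeq.code s) = head 0 s.
Proof. by case: s => [|x s] //; rewrite -consc_code hdc_cons. Qed.

Lemma dropc_code s i : dropc (CodeSeq.code s) i = CodeSeq.code (drop i s).
Proof.
elim: i s => [|i IH] s; first by rewrite drop0.
rewrite /dropc iterSr -/(dropc _ i).
by case: s => [|x s]; [exact: (IH [::]) | rewrite -consc_code tlc_cons IH].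
Qed.

Lemma nthc_code s i : nthc (CodeSeq.code s) i = nth 0 s i.
Proof. by rewrite /nthc dropc_code hdc_code -nth0 nth_drop addn0. Qed.

Lemma code_eq0 s : (CodeSeq.code s == 0) = (s == [::]).
Proof.
case: s => [|x s] //; rewrite -consc_code.
by apply/eqP => E; have := consc_gtl x (CodeSeq.code s); rewrite E.
Qed.

Lemma size_code s : size s <= CodeSeq.code s.
Proof.
elim: s => //= x s IH; rewrite -/(consc _ _).
by apply: leq_ltn_trans (consc_gtr _ _).
Qed.

(** The code of a list bounds its length, so [l] rounds are enough; rounds past the end keep the
    accumulator. *)
Definition foldc (f : nat -> nat -> nat) a l :=
  iteri l (fun i acc => if dropc l i == 0 then acc else f acc (hdc (dropc l i))) a.

Lemma foldc_code f a s : foldc f a (CodeSeq.code s) = foldl f a s.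
Proof.
rewrite /foldc.
have H k : iteri k (fun i acc => if dropc (CodeSeq.code s) i == 0 then acc
     else f acc (hdc (dropc (CodeSeq.code s) i))) a = foldl f a (take k s).
  elim: k => [|k IH]; first by rewrite take0.
  rewrite /= IH dropc_code code_eq0 hdc_code -nth0 nth_drop addn0.
  case: (ltnP k (size s)) => ks.
    by rewrite (take_nth 0 ks) -cats1 foldl_cat (drop_nth 0 ks).
  by rewrite drop_oversize // !take_oversize // ltnW.
by rewrite H take_oversize // size_code.
Qed.

Lemma pr_consc f g : PR f -> PR g -> PR (fun e => consc (f e) (g e)).
Proof.
move=> pf pg; apply: (pr_ext (f := fun e => 2 ^ f e * (g e + g e).+1)); first by pr.
by move=> e; rewrite /consc addnn.
Qed.
#[local] Hint Resolve pr_consc : pr.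

Lemma pr_hdc f : PR f -> PR (fun e => hdc (f e)).
Proof. by move=> pf; apply: (pr_app1 (F := hdc)) => //; rewrite /hdc; pr. Qed.

Lemma pr_tlc f : PR f -> PR (fun e => tlc (f e)).
Proof. by move=> pf; apply: (pr_app1 (F := tlc)) => //; rewrite /tlc; pr. Qed.
#[local] Hint Resolve pr_hdc pr_tlc : pr.

Lemma pr_dropc f g : PR f -> PR g -> PR (fun e => dropc (f e) (g e)).
Proof.
move=> pf pg.
apply: (pr_ext (f := fun e => iteri (g e) (fun _ acc => tlc acc) (f e))).
  by apply: (pr_rec (g := fun _ acc _ => tlc acc)) => //; pr.
by move=> e; rewrite /dropc; elim: (g e) => //= k ->.
Qed.

Lemma pr_nthc f g : PR f -> PR g -> PR (fun e => nthc (f e) (g e)).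
Proof. by move=> pf pg; apply: pr_hdc; apply: pr_dropc. Qed.
#[local] Hint Resolve pr_dropc pr_nthc : pr.

Lemma pr_foldc (F : nat -> nat -> nat -> nat -> nat) p q a l :
  PR (fun e => F (nth 0 e 0) (nth 0 e 1) (nth 0 e 2) (nth 0 e 3)) ->
  PR p -> PR q -> PR a -> PR l ->
  PR (fun e => foldc (F (p e) (q e)) (a e) (l e)).
Proof.
move=> pF pp pq pa pl.
apply: (@pr_app4 (fun x y z t => foldc (F x y) z t)) => //.
have step x y z t := pr_app4 (F := F) (f := x) (g := y) (h := z) (k := t) pF.
rewrite /foldc; apply: (pr_rec (g := fun i acc e =>
  if dropc (nth 0 e 3) i == 0 then acc else
  F (nth 0 e 0) (nth 0 e 1) acc (hdc (dropc (nth 0 e 3) i)))); pr.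
Qed.

(** This turns the finitely many relevant values of the functions in a certificate into a number. *)
Lemma table_exists (f : nat -> nat) (s : seq nat) :
  exists l, forall i, i \in s -> nthc l i = f i.
Proof.
exists (CodeSeq.code (mkseq f (\max_(i <- s) i).+1)) => i si.
by rewrite nthc_code nth_mkseq // ltnS (big_rem i) //= leq_maxl.
Qed.

(** * Regular languages *)

Definition lang := seq nat -> Prop.

(** Acceptance by a complete deterministic finite automaton, reading arbitrary natural numbers as
    letters. *)
Definition regular (K : lang) :=
  exists (Q : finType) (d : Q -> nat -> Q) (q0 : Q) (F : pred Q),
    forall x, K x <-> F (foldl d q0 x).

Lemma regular_ext K K' : regular K -> (forall x, K x <-> K' x) -> regular K'.
Proof.
by move=> [Q [d [q0 [F KF]]]] KK'; exists Q, d, q0, F => x; rewrite -KK'.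
Qed.

Lemma regular_empty : regular (fun=> False).
Proof. by exists unit, (fun _ _ => tt), tt, pred0. Qed.

Lemma regular_nil : regular (fun x => x = [::]).
Proof.
exists bool, (fun _ _ => false), true, id => -[|a x] //=.
have -> : foldl (fun _ _ => false) false x = false by elim: x.
by [].
Qed.

Lemma regular_letter a : regular (fun x => x = [:: a]).
Proof.
(* [Some false] is the initial state, [Some true] the accepting one, [None] a sink. *)
pose d q b : option bool :=
  if q == Some false then (if b == a then Some true else None) else None.
exists (option bool), d, (Some false), (fun q => q == Some true) => -[|b x] //=.
rewrite {2}/d eqxx.
have dN y : foldl d None y = None by elim: y.
case: (b =P a) => [->|nba]; last by rewrite dN; split=> // -[].
case: x => [|c x] //=; have -> : d (Some true) c = None by [].
by rewrite dN.
Qed.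

Lemma regular_union K1 K2 :
  regular K1 -> regular K2 -> regular (fun x => K1 x \/ K2 x).
Proof.
move=> [Q1 [d1 [q1 [F1 KF1]]]] [Q2 [d2 [q2 [F2 KF2]]]].
exists (Q1 * Q2)%type, (fun q a => (d1 q.1 a, d2 q.2 a)), (q1, q2),
  (fun q => F1 q.1 || F2 q.2) => x.
have -> : foldl (fun q a => (d1 q.1 a, d2 q.2 a)) (q1, q2) x
          = (foldl d1 q1 x, foldl d2 q2 x).
  by elim: x q1 q2 {KF1 KF2} => //= a x IH q1 q2; rewrite IH.
by rewrite KF1 KF2 /=; split=> [/orP|/orP].
Qed.

(** Subset construction: the state pairs the state of the first automaton with all states of the
    second one reached from splits whose first part is in [K1]. *)
Lemma regular_cat K1 K2 : regular K1 -> regular K2 ->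
  regular (fun x => exists y z, [/\ K1 y, K2 z & x = y ++ z]).
Proof.
move=> [Q1 [d1 [q1 [F1 KF1]]]] [Q2 [d2 [q2 [F2 KF2]]]].
pose ini q := if F1 q then [set q2] else set0.
pose d (q : Q1 * {set Q2}) a :=
  let q' := d1 q.1 a in (q', [set d2 p a | p in q.2] :|: ini q').
exists (Q1 * {set Q2})%type, d, (q1, ini q1), (fun q : Q1 * {set Q2} => [exists p in q.2, F2 p]) => x.
have [f1 f2] : (foldl d (q1, ini q1) x).1 = foldl d1 q1 x /\
    forall p, (p \in (foldl d (q1, ini q1) x).2) <->
      exists y z, [/\ K1 y, x = y ++ z & p = foldl d2 q2 z].
  elim/last_ind: x => [|x a [IH1 IH2]] /=.
    split=> // p; rewrite /ini; split.
      case: ifP => F1q; rewrite ?inE // => /eqP ->.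
      by exists [::], [::]; split=> //; apply/KF1.
    move=> [y [z [/KF1 Fy]]]; case: y Fy => //; case: z => // /= -> _ ->.
    by rewrite inE.
  rewrite -cats1 foldl_cat /= IH1; split; first by rewrite foldl_cat.
  move=> p; rewrite inE; split.
    case/orP => [/imsetP[p' /IH2[y [z [Ky -> ->]]] ->]|].
      by exists y, (z ++ [:: a]); rewrite catA foldl_cat.
    rewrite /ini; case: ifP => F1q; rewrite ?inE // => /eqP ->.
    by exists (x ++ [:: a]), [::]; rewrite cats0; split=> //; apply/KF1; rewrite foldl_cat.
  move=> [y [z [Ky E ->]]]; case: (lastP z) E => [|z' b] E.
    rewrite cats0 in E; move/KF1: Ky; rewrite -E foldl_cat /= => F1q.
    by rewrite /ini F1q inE eqxx orbT.
  move: E; rewrite cats1 -rcons_cat => /rcons_inj[xE ->].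
  apply/orP; left; rewrite -cats1 foldl_cat /=; apply: imset_f.
  by apply/IH2; exists y, z'.
split=> [[y [z [Ky /KF2 Fz xE]]]|/existsP[p /andP[/f2[y [z [Ky xE ->]]] Fz]]].
  by apply/existsP; exists (foldl d2 q2 z); rewrite Fz andbT; apply/f2; exists y, z.
by exists y, z; split=> //; apply/KF2.
Qed.

Definition star (K : lang) : lang :=
  fun x => exists l : seq (seq nat), (forall y, y \in l -> K y) /\ x = flatten l.

(** The last nonempty factor ends with the last letter; trailing empty factors are discarded. *)
Lemma star_rcons (K : lang) x a :
  star K (rcons x a) <->
  exists y z, [/\ star K y, K (rcons z a) & x = y ++ z].
Proof.
split=> [[l [Kl]]|[y [z [[l [Kl ->]] Kz ->]]]]; last first.
  exists (rcons l (rcons z a)); split; last by rewrite flatten_rcons rcons_cat.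
  by move=> w; rewrite mem_rcons inE => /predU1P[->|/Kl].
elim/last_ind: l Kl => [|l w IH] Kl /= E; first by case: x E.
have Kl' y : y \in l -> K y by move=> yl; apply: Kl; rewrite mem_rcons inE yl orbT.
case: (lastP w) E Kl => [|w' b] E Kl.
  by apply: IH => //; rewrite E flatten_rcons cats0.
move: E; rewrite flatten_rcons -rcons_cat => /rcons_inj[xE ab].
exists (flatten l), w'; split=> //; first by exists l.
by rewrite ab; apply: Kl; rewrite mem_rcons mem_head.
Qed.

(** The set holds the states reached from [q0] on a suffix whose complementary prefix is in the
    star. The boolean records membership of the whole word; it starts at [true] for the empty word,
    whether or not [q0] is accepting. *)
Lemma regular_star K : regular K -> regular (star K).
Proof.
move=> [Q [d [q0 [F KF]]]].
pose D (q : bool * {set Q}) a :=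
  let Y := [set d p a | p in q.2] in
  let b := [exists p in Y, F p] in (b, Y :|: (if b then [set q0] else set0)).
exists (bool * {set Q})%type, D, (true, [set q0]), (fun q => q.1) => x.
suff [-> //] : (star K x <-> (foldl D (true, [set q0]) x).1) /\
    forall p, (p \in (foldl D (true, [set q0]) x).2) <->
      exists y z, [/\ star K y, x = y ++ z & p = foldl d q0 z].
elim/last_ind: x => [|x a [IH1 IH2]] /=.
  split; first by split=> // _; exists [::].
  move=> p; rewrite inE; split=> [/eqP->|[[|? ?] [[|? ?] [_ E ->]]]] //.
  by exists [::], [::]; split=> //; exists [::].
rewrite -[in foldl _ _ _]cats1 foldl_cat /=; set q := foldl D _ x in IH1 IH2 *.
set Y := [set d p a | p in q.2]; set b := [exists p in Y, F p].
have YP p : (p \in Y) <-> exists y z, [/\ star K y, x = y ++ z & p = foldl d q0 (rcons z a)].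
  split=> [/imsetP[p' /IH2[y [z [Ky xE ->]]] ->]|[y [z [Ky xE ->]]]].
    by exists y, z; rewrite -cats1 foldl_cat.
  by rewrite -cats1 foldl_cat /=; apply: imset_f; apply/IH2; exists y, z.
have bP : star K (rcons x a) <-> b.
  rewrite star_rcons; split=> [[y [z [Ky /KF Kz xE]]]|/existsP[p /andP[/YP[y [z [Ky xE ->]]] Fz]]].
    apply/existsP; exists (foldl d q0 (rcons z a)); rewrite Kz andbT.
    by apply/YP; exists y, z.
  by exists y, z; split=> //; apply/KF.
split=> // p; rewrite inE; split.
  case/orP => [/YP[y [z [Ky -> ->]]]|].
    by exists y, (rcons z a); rewrite rcons_cat.
  case: ifP => Hb; rewrite ?inE // => /eqP ->.
  by exists (rcons x a), [::]; rewrite cats0; split=> //; apply/bP.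
move=> [y [z [Ky E ->]]]; case: (lastP z) E => [|z' c] E.
  rewrite cats0 in E; rewrite -E in Ky; move/bP: Ky => ->.
  by rewrite inE eqxx orbT.
move: E; rewrite -rcons_cat => /rcons_inj[xE <-].
by apply/orP; left; apply/YP; exists y, z'.
Qed.

Lemma regular_word w : regular (fun x => x = w).
Proof.
elim: w => [|a w IH]; first exact: regular_nil.
apply: regular_ext (regular_cat (regular_letter a) IH) _ => x.
by split=> [[y [z [-> -> ->]]]|->] //; exists [:: a], w.
Qed.

Lemma regular_seq (s : seq (seq nat)) : regular (fun x => x \in s).
Proof.
elim: s => [|w s IH]; first exact: regular_ext regular_empty _.
apply: regular_ext (regular_union (regular_word w) IH) _ => x.
by rewrite inE; split=> [[->|->]|/predU1P]; rewrite ?eqxx ?orbT.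
Qed.

(** A product automaton serves all the languages at once; only the accepting set depends on the
    index. *)
Lemma regular_family (I : eqType) (s : seq I) (K : I -> lang) :
  (forall i, i \in s -> regular (K i)) ->
  exists (Q : finType) (d : Q -> nat -> Q) (q0 : Q) (F : I -> pred Q),
    forall i x, i \in s -> (K i x <-> F i (foldl d q0 x)).
Proof.
elim: s => [|j s IH] Ks; first by exists unit, (fun _ _ => tt), tt, (fun _ => pred0).
have [|Q1 [d1 [q1 [F1 KF1]]]] := IH.
  by move=> i si; apply: Ks; rewrite inE si orbT.
have [Q2 [d2 [q2 [F2 KF2]]]] := Ks j (mem_head _ _).
exists (Q1 * Q2)%type, (fun q a => (d1 q.1 a, d2 q.2 a)), (q1, q2),
  (fun i q => if i == j then F2 q.2 else F1 i q.1) => i x ij.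
have -> : foldl (fun q a => (d1 q.1 a, d2 q.2 a)) (q1, q2) x
          = (foldl d1 q1 x, foldl d2 q2 x).
  by elim: x q1 q2 {KF1 KF2} => //= a x IHx q1 q2; rewrite IHx.
move: ij; rewrite inE /=; case: eqP => [-> _|_ /= si]; [exact: KF2 | exact: KF1].
Qed.

(* The transition monoid of a common automaton, with its elements numbered. *)
Lemma regular_congruence (I : eqType) (s : seq I) (K : I -> lang) :
  (forall i, i \in s -> regular (K i)) ->
  exists N (phi : seq nat -> nat) (rep : nat -> seq nat) (Kb : I -> pred (seq nat)),
    [/\ forall x, phi x < N,
        forall x, phi (rep (phi x)) = phi x,
        forall x y a, phi x = phi y ->
          phi (rcons x a) = phi (rcons y a) /\ phi (a :: x) = phi (a :: y),
        forall i x y, phi x = phi y -> Kb i x = Kb i y &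
        forall i x, i \in s -> (K i x <-> Kb i x)].
Proof.
case/regular_family=> Q [d [q0 [F KF]]].
(* Words are compared by their action on all states, not just on [q0], so the equivalence is also
   compatible with prepending a letter. *)
pose psi x : {ffun Q -> Q} := [ffun q => foldl d q x].
pose phi x := nat_of_ord (enum_rank (psi x)).
have psiE x y : phi x = phi y -> forall q, foldl d q x = foldl d q y.
  move=> /val_inj /enum_rank_inj /ffunP E q; have := E q.
  by rewrite !ffunE.
have phiE x y : (forall q, foldl d q x = foldl d q y) -> phi x = phi y.
  by move=> E; rewrite /phi; congr (nat_of_ord (enum_rank _)); apply/ffunP => q; rewrite !ffunE.
pose rep m := epsilon (inhabits [::]) (fun x => phi x = m).
exists #|{ffun Q -> Q}|, phi, rep, (fun i x => F i (foldl d q0 x)); split=> //.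
- by move=> x; apply: ltn_ord.
- by move=> x; apply: (epsilon_spec (inhabits [::]) (fun y => phi y = phi x)); exists x.
- move=> x y a /psiE E; split; apply: phiE => q /=; last exact: E.
  by rewrite -!cats1 !foldl_cat /= E.
- by move=> i x y /psiE ->.
Qed.

(** * Certificates of instability *)

(* A run is a list of triples (edge, message, target state); [t p e b q] says
   that there is a transition from p to q handling message b on edge e. *)
Definition trel := nat -> nat -> nat -> nat -> bool.
Definition letters := seq (nat * nat * nat).

Fixpoint run (t : trel) (p : nat) (s : letters) : bool :=
  if s is (e, b, q) :: s' then t p e b q && run t q s' else true.

Definition final (p : nat) (s : letters) := last p (map snd s).

Definition proj (e : nat) (s : letters) := [seq x.1.2 | x <- s & x.1.1 == e].

Lemma run_rcons t p s e b q :
  run t p (rcons s (e, b, q)) = run t p s && t (final p s) e b q.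
Proof.
elim: s p => [|[[e' b'] q'] s IH] p /=; first by rewrite andbT.
by rewrite IH andbA.
Qed.

Lemma final_rcons p s x : final p (rcons s x) = x.2.
Proof. by rewrite /final map_rcons last_rcons. Qed.

Lemma proj_rcons e s x :
  proj e (rcons s x) = if x.1.1 == e then rcons (proj e s) x.1.2 else proj e s.
Proof. by rewrite /proj filter_rcons; case: ifP => //; rewrite map_rcons. Qed.

Lemma proj_cons e s x :
  proj e (x :: s) = if x.1.1 == e then x.1.2 :: proj e s else proj e s.
Proof. by rewrite /proj /=; case: ifP. Qed.

(** Numbers [m < N] stand for classes of words, [u] for that of the empty word; [rho m a] appends
    [a] and [lam a m] prepends it. [acc e m p q] claims to cover states [p], [q] with content of
    class [m] on [e] and nothing on [1 - e]. It is closed under a send on [e], a receive from [e],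
    and a send on [1 - e] that is read at once; with both channels empty, the choice of [e] is
    immaterial. *)
Definition certificate (c : nat) (t0 t1 : trel) (h0 h1 s0 s1 N u : nat)
    (rho lam : nat -> nat -> nat) (acc : trel) : bool :=
  [&& u < N,
      all_lt N (fun m => all_lt c (fun a => rho m a < N)),
      all_lt c (fun a => lam a u == rho u a),
      all_lt N (fun m => all_lt c (fun a => all_lt c (fun b =>
        lam a (rho m b) == rho (lam a m) b))),
      all_lt 2 (fun e => all_lt N (fun m => all_lt c (fun p => all_lt c (fun q =>
        all_lt c (fun b => all_lt c (fun s =>
        [&& t0 p e b s && acc e m p q ==> acc e (rho m b) s q,
            t1 q e b s && acc e (lam b m) p q ==> acc e m p s &
            all_lt c (fun s' =>
              [&& t0 p (1 - e) b s, t1 q (1 - e) b s' & acc e m p q]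
                ==> acc e m s s')])))))),
      all_lt c (fun p => all_lt c (fun q =>
        (acc 0 u p q ==> acc 1 u p q) && (acc 1 u p q ==> acc 0 u p q))),
      acc 0 u h0 h1 &
      ~~ acc 0 u s0 s1].

Definition bounded (c : nat) (t : trel) :=
  forall p e b q, t p e b q -> [/\ p < c, e < 2, b < c & q < c].

(* The receiver reads as soon as it can, so that at any time one of the two
   channels is empty: x is the content of e, and the channel 1 - e is empty. *)
Lemma certificate_sound c t0 t1 h0 h1 s0 s1 N u rho lam acc s r :
  bounded c t0 -> bounded c t1 -> h0 < c -> h1 < c ->
  certificate c t0 t1 h0 h1 s0 s1 N u rho lam acc ->
  run t0 h0 s -> run t1 h1 r -> final h0 s = s0 -> final h1 r = s1 ->
  proj 0 s = proj 0 r -> proj 1 s = proj 1 r -> False.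
Proof.
move=> t0c t1c h0c h1c.
move=> /and5P[uN /all_ltP rhoN /all_ltP lamu /all_ltP lamrho].
move=> /and4P[/all_ltP closed /all_ltP acc01 acch accs] rs rr fs fr p0 p1.
pose phi x := foldl rho u x.
have phiN x : all (ltn^~ c) x -> phi x < N.
  elim/last_ind: x => //= x a IH; rewrite all_rcons => /andP[ac xc].
  by rewrite /phi foldl_rcons; apply: (all_ltP _ _ (rhoN _ (IH xc))).
have phi_cons x a : all (ltn^~ c) x -> a < c -> phi (a :: x) = lam a (phi x).
  move=> xc ac; elim/last_ind: x xc => [|x b IH] /=; first by rewrite (eqP (lamu _ ac)).
  rewrite all_rcons => /andP[bc xc].
  rewrite -rcons_cons /phi !foldl_rcons -/(phi _) -/(phi _) IH //.
  have /all_ltP/(_ a ac)/all_ltP/(_ b bc)/eqP -> // := lamrho _ (phiN _ xc).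
have acc_swap e e' p q : e < 2 -> e' < 2 -> p < c -> q < c -> acc e u p q -> acc e' u p q.
  move=> e2 e'2 pc qc; have /all_ltP/(_ q qc)/andP[H H'] := acc01 _ pc.
  by case: e e2 => [|[|]] // _; case: e' e'2 => [|[|]] // _; apply/implyP.
have rule e m p q b a : e < 2 -> m < N -> p < c -> q < c -> b < c -> a < c -> _ :=
  fun e2 mN pc qc bc ac => all_ltP _ _ (all_ltP _ _ (all_ltP _ _ (all_ltP _ _ (all_ltP _ _ (closed e e2) m mN) p pc) q qc) b bc) a ac.
have sendP e x p q b p' : e < 2 -> all (ltn^~ c) x -> q < c -> t0 p e b p' ->
    acc e (phi x) p q -> acc e (phi (rcons x b)) p' q.
  move=> e2 xc qc tp ap; have [pc _ bc pc'] := t0c _ _ _ _ tp.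
  have /and3P[/implyP H _ _] := rule e _ p q b p' e2 (phiN _ xc) pc qc bc pc'.
  by rewrite /phi foldl_rcons; apply: H; rewrite tp.
have recvP e x p q b q' : e < 2 -> all (ltn^~ c) x -> p < c -> t1 q e b q' ->
    acc e (phi (b :: x)) p q -> acc e (phi x) p q'.
  move=> e2 xc pc tq; have [qc _ bc qc'] := t1c _ _ _ _ tq; rewrite phi_cons // => ap.
  have /and3P[_ /implyP H _] := rule e _ p q b q' e2 (phiN _ xc) pc qc bc qc'.
  by apply: H; rewrite tq.
have syncP e x p q b p' q' : e < 2 -> all (ltn^~ c) x ->
    t0 p (1 - e) b p' -> t1 q (1 - e) b q' ->
    acc e (phi x) p q -> acc e (phi x) p' q'.
  move=> e2 xc tp tq ap; have [pc _ bc pc'] := t0c _ _ _ _ tp.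
  have [qc _ _ qc'] := t1c _ _ _ _ tq.
  have /and3P[_ _ /all_ltP H] := rule e _ p q b p' e2 (phiN _ xc) pc qc bc pc'.
  by apply: (implyP (H _ qc')); rewrite tp tq.
(* Induction on the total length of the remaining runs [s] and [r]; what is pending on [e] followed
   by what is still to be sent there is what is still to be read. *)
have main n : forall e x p q s r, size s + size r < n -> e < 2 ->
    p < c -> q < c -> all (ltn^~ c) x -> run t0 p s -> run t1 q r ->
    x ++ proj e s = proj e r -> proj (1 - e) s = proj (1 - e) r ->
    acc e (phi x) p q -> acc 0 u (final p s) (final q r).
  elim: n => // n IH e x p q {rs fs p0 p1}s {rr fr}r ln e2 pc qc xc rs rr Ee E1e ap.
  have e1e : 1 - e < 2 by lia.
  have ne1e : (e == 1 - e) = false by lia.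
  have n1ee : (1 - e == e) = false by lia.
  have dich f : f < 2 -> f = e \/ f = 1 - e by lia.
  have e11 : 1 - (1 - e) = e by lia.
  case: r ln rr Ee E1e => [|[[f b] q'] r] ln /=.
    (* If the receiver is done, nothing is pending and the sender is done too, since any further
       message would remain unread. *)
    move=> _ Ee E1e; case: s rs Ee E1e {ln} => [|[[f b] p'] s] /=.
      rewrite cats0 => _ x0 _; rewrite x0 in ap.
      exact: (acc_swap e 0).
    case/andP=> /t0c[_ f2 _ _] _; rewrite !proj_cons /=.
    by case: (dich f f2) => ->; rewrite eqxx //; case: x {ap xc}.
  case/andP=> tq rr; have [_ f2 bc qc'] := t1c _ _ _ _ tq.
  rewrite !(proj_cons _ r) /=; case: (dich f f2) => fE; subst f; rewrite eqxx.
    (* The receiver wants a message from [e]: it takes a pending one if there is one; otherwise the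
       sender has to move. *)
    rewrite ne1e; case: x xc ap => [|a x] xc ap /=; last first.
      case=> ab Ee E1e; subst a; case/andP: xc => _ xc.
      apply: (IH e x p q' s r) => //; last exact: recvP tq ap.
      by rewrite /= addnS in ln.
    case: s rs ln => [|[[f b'] p'] s] //= /andP[tp rs] ln.
    have [_ f2' bc' pc'] := t0c _ _ _ _ tp.
    rewrite !(proj_cons _ s) /=; case: (dich f f2') => fE; subst f; rewrite eqxx.
      rewrite ne1e => -[b'b Ee] E1e; subst b'.
      apply: (IH e [:: b] p' q s ((e, b, q') :: r)) => //=.
      + by rewrite bc.
      + by rewrite tq.
      + by rewrite proj_cons /= eqxx Ee.
      + by rewrite proj_cons /= ne1e.
      + exact: (sendP e [::] p q b p').
    (* The sender uses [1 - e] while [e] is empty: from here on [1 - e] is the channel whose content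
       is tracked. *)
    rewrite n1ee => Ee E1e.
    apply: (IH (1 - e) [:: b'] p' q s ((e, b, q') :: r)) => //=.
    + by rewrite bc'.
    + by rewrite tq.
    + by rewrite proj_cons /= ne1e.
    + by rewrite e11 proj_cons /= eqxx.
    + by apply: (sendP (1 - e) [::] p q b' p') => //; apply: (acc_swap e).
  (* The receiver waits on the empty channel [1 - e]. The sender either adds to [e], or sends on
     [1 - e] exactly the awaited message, which is read immediately. *)
  rewrite n1ee => Ee; case: s rs ln Ee => [|[[f b'] p'] s] //= /andP[tp rs] ln.
  have [_ f2' bc' pc'] := t0c _ _ _ _ tp.
  rewrite !(proj_cons _ s) /=; case: (dich f f2') => fE; subst f; rewrite eqxx.
    rewrite ne1e => Ee E1e.
    apply: (IH e (rcons x b') p' q s ((1 - e, b, q') :: r)) => //=.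
    + by rewrite all_rcons /= bc'.
    + by rewrite tq.
    + by rewrite proj_cons /= n1ee cat_rcons.
    + by rewrite proj_cons /= eqxx.
    + exact: sendP tp ap.
  rewrite n1ee => Ee -[b'b E1e]; subst b'.
  apply: (IH e x p' q' s r) => //; last exact: syncP tp tq ap.
  by move: ln; lia.
move: accs; rewrite -fs -fr => /negP; apply.
exact: (main _ 0 [::] h0 h1 s r (ltnSn _)).
Qed.

(** * Protocols with two parallel edges *)

Definition trans_rel (P : protocol) (j : nat) : trel :=
  fun p e b q => (p, (j == 0, e, b), q) \in nth [::] (trans P) j.

Definition chan (e : nat) (x : seq nat) : channel :=
  if e == 0 then [:: x; [::]] else [:: [::]; x].

Lemma two_parallel_C0 P : two_parallel_edges P -> C0 P = [:: [::]; [::]].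
Proof. by case=> _ E; rewrite /C0 E. Qed.

Lemma seq2E (T : Type) (x0 : T) (s : seq T) :
  size s = 2 -> s = [:: nth x0 s 0; nth x0 s 1].
Proof. by case: s => [|a [|b []]]. Qed.

Section TwoParallel.

Variable P : protocol.
Hypothesis wfP : wf P.
Hypothesis tpP : two_parallel_edges P.

Let h0 := nth 0 (init P) 0.
Let h1 := nth 0 (init P) 1.
Let t0 := trans_rel P 0.
Let t1 := trans_rel P 1.

Lemma init2 : init P = [:: h0; h1].
Proof. by apply: seq2E; case: wfP => _ [_ [_ [-> _]]]; case: tpP. Qed.

Lemma size_msize2 : size (msize P) = 2.
Proof. by case: wfP => <- _; case: tpP => _ ->. Qed.

Lemma transP j p snd e b q :
  j < 2 -> (p, (snd, e, b), q) \in nth [::] (trans P) j ->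
  [/\ p < nth 0 (nstates P) j, q < nth 0 (nstates P) j,
      e < 2, b < nth 0 (msize P) e & snd = (j == 0)].
Proof.
case: wfP => _ [_ [_ [_ [_ [_ H]]]]]; case: tpP => nn E j2 tin.
have := H j _ _ tin; rewrite nn => /(_ j2) /=; rewrite E => -[pn qn e2 bm] E'.
split=> //; move: E'; by case: e e2 {bm tin} => [|[|]] // _; case: snd; case: j j2 {pn qn} => [|[|]].
Qed.

Lemma step_inv p q x y g : step P ([:: p; q], [:: x; y]) g ->
  [\/ exists p' b, t0 p 0 b p' /\ g = ([:: p'; q], [:: rcons x b; y]),
      exists p' b, t0 p 1 b p' /\ g = ([:: p'; q], [:: x; rcons y b]),
      exists q' b x', [/\ t1 q 0 b q', x = b :: x' & g = ([:: p; q'], [:: x'; y])] |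
      exists q' b y', [/\ t1 q 1 b q', y = b :: y' & g = ([:: p; q'], [:: x; y'])]].
Proof.
move Eg: (_, _) => g0 st; case: tpP => nn _.
case: st Eg => [j p0 q0 e b S C|j p0 q0 e b rest S C]; rewrite nn => j2 tin pE.
  have [_ _ e2 _ sE] := transP j2 tin.
  case: j j2 tin pE sE => [|[|]] // _ tin pE _ [SE CE]; subst.
  by case: e e2 tin => [|[|]] // _ tin; [constructor 1 | constructor 2]; exists q0, b.
move=> CE; have [_ _ e2 _ sE] := transP j2 tin.
case: j j2 tin pE sE => [|[|]] // _ tin pE _ [SE CE']; subst.
by case: e e2 tin CE => [|[|]] // _ tin /= ->; [constructor 3 | constructor 4];
  exists q0, b, rest.
Qed.

Lemma step_send_chan e b p p' q x y : t0 p e b p' ->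
  step P ([:: p; q], [:: x; y])
    ([:: p'; q], set_nth [::] [:: x; y] e (rcons (nth [::] [:: x; y] e) b)).
Proof.
by move=> tp; apply: (@step_send P 0 p p' e b [:: p; q]) => //; case: tpP => ->.
Qed.

Lemma step_recv_chan e b p q q' x y z : t1 q e b q' ->
  nth [::] [:: x; y] e = b :: z ->
  step P ([:: p; q], [:: x; y]) ([:: p; q'], set_nth [::] [:: x; y] e z).
Proof.
by move=> tq E; apply: (@step_recv P 1 q q' e b z [:: p; q]) => //; case: tpP => ->.
Qed.

(** The invariant of first-in first-out channels: what was sent is what was received followed by
    what is pending. *)
Lemma reachable_runs g : reachable P g ->
  exists s r x y, [/\ run t0 h0 s, run t1 h1 r,
    g = ([:: final h0 s; final h1 r], [:: x; y]),
    proj 0 s = proj 0 r ++ x & proj 1 s = proj 1 r ++ y].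
Proof.
elim=> [|g1 g2 _ [s [r [x [y [rs rr -> E0 E1]]]]] /step_inv].
  by exists [::], [::], [::], [::]; rewrite init2 two_parallel_C0.
case=> [[p' [b [tp ->]]]|[p' [b [tp ->]]]|[q' [b [x' [tq xE ->]]]]|[q' [b [y' [tq yE ->]]]]].
- exists (rcons s (0, b, p')), r, (rcons x b), y.
  by rewrite run_rcons rs tp !proj_rcons /= final_rcons E0 E1 rcons_cat.
- exists (rcons s (1, b, p')), r, x, (rcons y b).
  by rewrite run_rcons rs tp !proj_rcons /= final_rcons E0 E1 rcons_cat.
- exists s, (rcons r (0, b, q')), x', y.
  by rewrite run_rcons rr tq !proj_rcons /= final_rcons E0 E1 xE cat_rcons.
- exists s, (rcons r (1, b, q')), x, y'.
  by rewrite run_rcons rr tq !proj_rcons /= final_rcons E0 E1 yE cat_rcons.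
Qed.

Lemma run_send s : run t0 h0 s ->
  reachable P ([:: final h0 s; h1], [:: proj 0 s; proj 1 s]).
Proof.
elim/last_ind: s => [_|s [[e b] p'] IH].
  by have := reach0 P; rewrite init2 two_parallel_C0.
rewrite run_rcons => /andP[/IH rch tp]; apply: reachS rch _.
have [_ _ e2 _ _] := @transP 0 _ _ _ _ _ isT tp.
rewrite final_rcons !proj_rcons /=; have := step_send_chan h1 (proj 0 s) (proj 1 s) tp.
by case: e e2 {tp} => [|[|]].
Qed.

Lemma run_recv r p q x y : run t1 q r ->
  reachable P ([:: p; q], [:: proj 0 r ++ x; proj 1 r ++ y]) ->
  reachable P ([:: p; final q r], [:: x; y]).
Proof.
elim: r q => [|[[e b] q'] r IH] q //= /andP[tq rr] rch.
apply: IH rr _; apply: reachS rch _.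
have [_ _ e2 _ _] := @transP 1 _ _ _ _ _ isT tq.
rewrite !(proj_cons _ r) /=.
case: e e2 tq => [|[|]] // _ tq /=.
  exact: (@step_recv_chan 0 _ _ _ _ _ _ _ tq).
exact: (@step_recv_chan 1 _ _ _ _ _ _ _ tq).
Qed.

(** All messages go from node 0 to node 1, so the sender can finish its run before the receiver
    starts; equality of the projections is then the only constraint. *)
Lemma stable_runs s0 s1 : stable P [:: s0; s1] <->
  exists s r, [/\ run t0 h0 s && run t1 h1 r, final h0 s = s0, final h1 r = s1,
    proj 0 s = proj 0 r & proj 1 s = proj 1 r].
Proof.
rewrite /stable two_parallel_C0 //; split.
  case/reachable_runs=> s [r [x [y [rs rr [-> -> <- <-]]]]].
  by rewrite !cats0 => E0 E1; exists s, r; rewrite rs rr.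
move=> [s [r [/andP[rs rr] <- <- E0 E1]]].
by apply: run_recv => //; rewrite !cats0 -E0 -E1; apply: run_send.
Qed.

(** The range conditions make the language empty for invalid states, about which the rational
    channel property says nothing. *)
Definition single (e p q : nat) : lang := fun x =>
  [/\ p < nth 0 (nstates P) 0, q < nth 0 (nstates P) 1 &
      reachable P ([:: p; q], chan e x)].

Lemma single_send e p q b p' x : e < 2 ->
  single e p q x -> t0 p e b p' -> single e p' q (rcons x b).
Proof.
move=> e2 [pn qn rch] tp; have [_ pn' _ _ _] := @transP 0 _ _ _ _ _ isT tp.
split=> //; apply: reachS rch _; case: e e2 tp => [|[|]] // _ tp.
  exact: (step_send_chan _ _ _ tp).
exact: (step_send_chan _ _ _ tp).
Qed.

Lemma single_recv e p q b q' x : e < 2 ->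
  single e p q (b :: x) -> t1 q e b q' -> single e p q' x.
Proof.
move=> e2 [pn qn rch] tq; have [_ qn' _ _ _] := @transP 1 _ _ _ _ _ isT tq.
split=> //; apply: reachS rch _; case: e e2 tq => [|[|]] // _ tq.
  exact: (@step_recv_chan 0 _ _ _ _ _ _ _ tq).
exact: (@step_recv_chan 1 _ _ _ _ _ _ _ tq).
Qed.

Lemma single_sync e p q b p' q' x : e < 2 ->
  single e p q x -> t0 p (1 - e) b p' -> t1 q (1 - e) b q' -> single e p' q' x.
Proof.
move=> e2 [pn qn rch] tp tq.
have [_ pn' _ _ _] := @transP 0 _ _ _ _ _ isT tp.
have [_ qn' _ _ _] := @transP 1 _ _ _ _ _ isT tq.
split=> //; case: e e2 rch tp tq => [|[|]] // _ rch tp tq.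
  apply: reachS (reachS rch (step_send_chan _ _ _ tp)) _.
  exact: (@step_recv_chan 1 _ _ _ _ _ _ _ tq).
apply: reachS (reachS rch (step_send_chan _ _ _ tp)) _.
exact: (@step_recv_chan 0 _ _ _ _ _ _ _ tq).
Qed.

Lemma rsem_size r C : rsem P r C -> size C = 2.
Proof.
elim: r C => [s|r1 IH1 r2 IH2|r1 IH1 r2 IH2|r IH] C /=.
- by rewrite /valid_ch size_msize2 => -[_ /andP[/eqP]].
- by case=> [/IH1|/IH2].
- by move=> [C1 [C2 [/IH1 s1 /IH2 s2 ->]]]; rewrite size_map size_zip s1 s2.
- move=> [l [Hl ->]]; elim: l Hl => [|C' l IHl] Hl /=; first by rewrite two_parallel_C0.
  have sC' : size C' = 2 by apply: IH; apply: Hl; rewrite mem_head.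
  rewrite size_map size_zip sC' IHl // => C'' C''l.
  by apply: Hl; rewrite inE C''l orbT.
Qed.

(** A concatenation is empty only if both factors are. The sizes matter because [zip] truncates. *)
Lemma cmul_chan e x C1 C2 : e < 2 -> size C1 = 2 -> size C2 = 2 ->
  chan e x = cmul C1 C2 <->
  exists y z, [/\ C1 = chan e y, C2 = chan e z & x = y ++ z].
Proof.
move=> e2 s1 s2; split; last first.
  by move=> [y [z [-> -> ->]]]; rewrite /chan /cmul; case: eqP.
rewrite (seq2E [::] s1) (seq2E [::] s2) /chan /cmul; move: (nth _ C1 0) (nth _ C1 1) => a b.
move: (nth _ C2 0) (nth _ C2 1) => a' b'; case: eqP => _ /= [].
  by case: b b' => [|? ?] [|? ?] // -> _; exists a, a'.
by case: a a' => [|? ?] [|? ?] // _ ->; exists b, b'.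
Qed.

Lemma chan_inj e : injective (chan e).
Proof. by move=> x y; rewrite /chan; case: eqP => _ []. Qed.

(* Factors of an element with empty component 1 - e have empty component 1 - e,
   so restricting to that component is compatible with products and stars. *)
Lemma rsem_regular r e : e < 2 -> regular (fun x => rsem P r (chan e x)).
Proof.
move=> e2; elim: r => [s|r1 IH1 r2 IH2|r1 IH1 r2 IH2|r IH] /=.
- pose s' := [seq nth [::] C e | C <- s & valid_ch P C && (C == chan e (nth [::] C e))].
  apply: regular_ext (regular_seq s') _ => x; split.
    case/mapP=> C; rewrite mem_filter => /andP[/andP[vC /eqP CE] Cs] ->.
    by rewrite -CE.
  move=> [xs vx]; apply/mapP; have nx : nth [::] (chan e x) e = x.
    by rewrite /chan; case: e e2 {xs vx s'} => [|[|]].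
  by exists (chan e x); rewrite ?nx // mem_filter vx nx eqxx.
- exact: regular_union.
- apply: regular_ext (regular_cat IH1 IH2) _ => x; split.
    by move=> [y [z [ry rz ->]]]; exists (chan e y), (chan e z); split=> //;
      apply/cmul_chan; rewrite ?(rsem_size ry) ?(rsem_size rz) //; exists y, z.
  move=> [C1 [C2 [r1C r2C]]]; move/cmul_chan.
  case; rewrite ?(rsem_size r1C) ?(rsem_size r2C) // => y [z [C1E C2E ->]].
  by exists y, z; rewrite -C1E -C2E.
- have C0E : C0 P = chan e [::] by rewrite two_parallel_C0 // /chan; case: eqP.
  apply: regular_ext (regular_star IH) _ => x; split.
    move=> [l [Hl ->]]; exists (map (chan e) l); split; first by move=> C /mapP[y /Hl ? ->].
    elim: l {Hl} => [|y l IHl] /=; first by rewrite C0E.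
    by rewrite -IHl /chan /cmul; case: eqP.
  move=> [l [Hl]]; rewrite C0E; elim: l x Hl => [|C l IHl] x Hl /=.
    by move/chan_inj->; exists [::].
  have Hl' C' : C' \in l -> rsem P r C' by move=> Cl; apply: Hl; rewrite inE Cl orbT.
  have rC := Hl C (mem_head _ _).
  have rl : rsem P (RStar r) (foldr cmul (chan e [::]) l) by exists l; rewrite C0E.
  move/cmul_chan; case; rewrite ?(rsem_size rC) ?(rsem_size rl) // => y [z [CE lE ->]].
  have [l' [Hl'' ->]] := IHl z Hl' (esym lE).
  exists (y :: l'); split=> // w; rewrite inE => /predU1P[->|/Hl'' //].
  by rewrite -CE.
Qed.

Lemma single_regular e p q : rational_channel_property P -> e < 2 ->
  regular (single e p q).
Proof.
move=> rcp e2; case: (boolP ((p < nth 0 (nstates P) 0) && (q < nth 0 (nstates P) 1))).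
  case/andP=> pn qn; have [|r rE] := rcp [:: p; q].
    by split=> [|j]; case: tpP => -> _ //; case: j => [|[|]].
  apply: regular_ext (rsem_regular r e2) _ => x; rewrite -rE /L_of.
  by split=> [|[]].
move=> npq; apply: regular_ext regular_empty _ => x; split=> // -[pn qn _].
by rewrite pn qn in npq.
Qed.

End TwoParallel.

(* rho', lam' and acc' are the finite tables to be encoded in a number: only
   their values at m < N and a, p, q < c matter. *)
Lemma certificate_complete P c s0 s1 :
  wf P -> two_parallel_edges P -> rational_channel_property P ->
  nth 0 (init P) 0 < c -> nth 0 (init P) 1 < c -> s0 < c -> s1 < c ->
  ~ stable P [:: s0; s1] ->
  exists N u (rho lam : nat -> nat -> nat) (acc : trel),
    forall (rho' lam' : nat -> nat -> nat) (acc' : trel),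
    (forall m a, m < N -> a < c -> rho' m a = rho m a) ->
    (forall m a, m < N -> a < c -> lam' a m = lam a m) ->
    (forall e m p q, e < 2 -> m < N -> p < c -> q < c ->
       acc' e m p q = acc e m p q) ->
    certificate c (trans_rel P 0) (trans_rel P 1) (nth 0 (init P) 0)
      (nth 0 (init P) 1) s0 s1 N u rho' lam' acc'.
Proof.
move=> wfP tpP rcp h0c h1c s0c s1c nst.
pose K (i : nat * nat * nat) := single P i.1.1 i.1.2 i.2.
pose dom : seq (nat * nat * nat) :=
  [seq (i, q) | i <- [seq (e, p) | e <- iota 0 2, p <- iota 0 c], q <- iota 0 c].
have domP e p q : e < 2 -> p < c -> q < c -> (e, p, q) \in dom.
  move=> e2 pc qc; apply/allpairsPdep; exists (e, p), q; rewrite mem_iota.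
  by split=> //; apply/allpairsPdep; exists e, p; rewrite !mem_iota.
have [|N [phi [rep [Kb [phiN repP cong KbP KE]]]]] := @regular_congruence _ dom K.
  move=> i /allpairsPdep[ep [q [/allpairsPdep[e [p [e2 _ ->]]] _ ->]]].
  by rewrite mem_iota in e2; apply: single_regular.
(* Everything is computed on the representative [rep m]. A number [m < N] that is no value of [phi]
   still gets some word, for which the closure conditions hold as well. *)
exists N, (phi [::]), (fun m a => phi (rcons (rep m) a)), (fun a m => phi (a :: rep m)),
  (fun e m p q => Kb (e, p, q) (rep m)) => rho' lam' acc' rhoE lamE accE.
have uN := phiN [::].
have accP e m p q x : e < 2 -> p < c -> q < c -> phi (rep m) = phi x -> m < N ->
    acc' e m p q <-> single P e p q x.
  by move=> e2 pc qc mx mN; rewrite accE // (KbP _ _ _ mx) -KE ?domP.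
have repc x a : phi (rcons (rep (phi x)) a) = phi (rcons x a) /\
                phi (a :: rep (phi x)) = phi (a :: x).
  by apply: cong.
(* At the class of the empty word both channels are empty, so the condition does not depend on [e];
   this gives the switching clause, the initial clause and the exclusion of the target state. *)
have accP0 e p q : e < 2 -> p < c -> q < c ->
    acc' e (phi [::]) p q <-> reachable P ([:: p; q], C0 P) /\ p < nth 0 (nstates P) 0 /\ q < nth 0 (nstates P) 1.
  move=> e2 pc qc; rewrite (accP _ _ _ _ [::]) // /single two_parallel_C0 //.
  have -> : chan e [::] = [:: [::]; [::]] by case: e e2 => [|[|]].
  by split=> [[]|[? []]].
rewrite /certificate uN /=; apply/and5P; split.
- apply/all_ltP => m mN; apply/all_ltP => a ac; by rewrite rhoE.
- apply/all_ltP => a ac; rewrite rhoE // lamE //.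
  by rewrite (repc [::] a).1 (repc [::] a).2.
- apply/all_ltP => m mN; apply/all_ltP => a ac; apply/all_ltP => b bc.
  rewrite !(rhoE, lamE) ?phiN //; apply/eqP.
  by rewrite (repc _ _).1 (repc _ _).2.
- apply/all_ltP => e e2; apply/all_ltP => m mN; apply/all_ltP => p pc.
  apply/all_ltP => q qc; apply/all_ltP => b bc; apply/all_ltP => s sc.
  apply/and3P; split.
  + apply/implyP => /andP[tp]; rewrite (accP _ _ _ _ (rep m)) // rhoE // => Kx.
    by apply/(accP _ _ _ _ (rcons (rep m) b)); rewrite ?repP //; apply: single_send Kx tp.
  + apply/implyP => /andP[tp]; rewrite lamE // (accP _ _ _ _ (b :: rep m)) ?repP // => Kx.
    by apply/(accP _ _ _ _ (rep m)) => //; apply: single_recv Kx tp.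
  + apply/all_ltP => s' sc'; apply/implyP => /and3P[tp tq].
    rewrite !(accP _ _ _ _ (rep m)) // => Kx.
    exact: single_sync Kx tp tq.
- apply/and3P; split.
  + apply/all_ltP => p pc; apply/all_ltP => q qc.
    by apply/andP; split; apply/implyP; rewrite !accP0.
  + apply/accP0 => //; split; first by have := reach0 P; rewrite {1}(init2 wfP tpP).
    have [_ [_ [_ [_ [_ [hn _]]]]]] := wfP; have [nn _] := tpP.
    by rewrite nn in hn; split; apply: hn.
  + by apply/negP => /(accP0 0 s0 s1 isT s0c s1c) [].
Qed.

(** * The decision procedure *)

Definition code2 a b := consc a (consc b 0).
Definition code4 a b c d := consc a (consc b (consc c (consc d 0))).
(** The value of [pickle] on a transition: nested pairs, each coded as a list of two numbers. *)
Definition trans_code (s p e b q : nat) :=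
  code2 (code2 p (code2 (code2 s e) b)) q.

(* In each of these, the first argument is the code of the input (P, S). *)
Definition init_of c j := nthc (nthc (nthc (nthc c 0) 0) 1) j.
Definition state_of c j := nthc (nthc c 1) j.
Definition trans_of c j := nthc (nthc (nthc c 0) 1) j.
Definition trans_test c j p e b q :=
  ex_lt c (fun i => nthc (trans_of c j) i == trans_code (j == 0) p e b q).

Lemma pr_code2 f g : PR f -> PR g -> PR (fun e => code2 (f e) (g e)).
Proof. by rewrite /code2; pr. Qed.

Lemma pr_code4 f g h k : PR f -> PR g -> PR h -> PR k ->
  PR (fun e => code4 (f e) (g e) (h e) (k e)).
Proof. by rewrite /code4; pr. Qed.
#[local] Hint Resolve pr_code2 pr_code4 : pr.

Lemma pr_init_of f g : PR f -> PR g -> PR (fun e => init_of (f e) (g e)).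
Proof. by rewrite /init_of; pr. Qed.

Lemma pr_state_of f g : PR f -> PR g -> PR (fun e => state_of (f e) (g e)).
Proof. by rewrite /state_of; pr. Qed.

Lemma pr_trans_test c j p e b q : PR c -> PR j -> PR p -> PR e -> PR b -> PR q ->
  PR (fun x => trans_test (c x) (j x) (p x) (e x) (b x) (q x)).
Proof.
apply: (@pr_app6 (fun c j p e b q => trans_test c j p e b q)).
by rewrite /trans_test /trans_of /trans_code; pr.
Qed.
#[local] Hint Resolve pr_init_of pr_state_of pr_trans_test : pr.

(* The accumulator is [validity; current state; reversed projections]. *)
Definition run_step c j acc x :=
  code4 ((nthc acc 0 == 1) &&
         trans_test c j (nthc acc 1) (nthc x 0) (nthc x 1) (nthc x 2))
    (nthc x 2)
    (if nthc x 0 == 0 then consc (nthc x 1) (nthc acc 2) else nthc acc 2)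
    (if nthc x 0 == 1 then consc (nthc x 1) (nthc acc 3) else nthc acc 3).

Definition run_code c j l := foldc (run_step c j) (code4 1 (init_of c j) 0 0) l.

(** The first two entries of [w] are a run of the sender and a run of the receiver. The projections
    are compared in reversed form. *)
Definition stable_test c w :=
  let a := run_code c 0 (nthc w 0) in
  let b := run_code c 1 (nthc w 1) in
  [&& nthc a 0 == 1, nthc b 0 == 1, nthc a 1 == state_of c 0,
      nthc b 1 == state_of c 1, nthc a 2 == nthc b 2 & nthc a 3 == nthc b 3].

(** The input code [c] itself bounds states and messages, since it exceeds every number occurring in
    the transitions, the initial states and the target. *)
Definition unstable_test c w :=
  certificate c (trans_test c 0) (trans_test c 1) (init_of c 0) (init_of c 1)
    (state_of c 0) (state_of c 1) (nthc w 0) (nthc w 1)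
    (fun m a => nthc (nthc w 2) (code2 m a))
    (fun a m => nthc (nthc w 3) (code2 a m))
    (fun e m p q => nthc (nthc w 4) (code4 e m p q) != 0).

Lemma pr_run_code f g h : PR f -> PR g -> PR h ->
  PR (fun e => run_code (f e) (g e) (h e)).
Proof.
move=> pf pg ph; apply: (pr_foldc (F := run_step)); try by pr.
by rewrite /run_step; pr.
Qed.
#[local] Hint Resolve pr_run_code : pr.

Lemma pr_stable_test f g : PR f -> PR g -> PR (fun e => stable_test (f e) (g e)).
Proof. by move=> pf pg; rewrite /stable_test; pr. Qed.

Lemma pr_unstable_test f g : PR f -> PR g -> PR (fun e => unstable_test (f e) (g e)).
Proof.
apply: (@pr_app2 (fun c w => unstable_test c w)).
by rewrite /unstable_test /certificate; pr.
Qed.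

Lemma code2E a b : code2 a b = CodeSeq.code [:: a; b].
Proof. by []. Qed.

Lemma code4E a b c d : code4 a b c d = CodeSeq.code [:: a; b; c; d].
Proof. by []. Qed.

Lemma nthc_code4 a b c d :
  [/\ nthc (code4 a b c d) 0 = a, nthc (code4 a b c d) 1 = b,
      nthc (code4 a b c d) 2 = c & nthc (code4 a b c d) 3 = d].
Proof. by rewrite code4E !nthc_code. Qed.

Lemma nthc_leq l i : nthc l i <= l.
Proof.
rewrite -{1}(CodeSeq.decodeK l) nthc_code.
case: (ltnP i (size (CodeSeq.decode l))) => sz; last by rewrite nth_default.
by apply: ltnW; apply: (allP (CodeSeq.gtn_decode l)); apply: mem_nth.
Qed.

Lemma nthc_ltn l i : 0 < l -> nthc l i < l.
Proof.
move=> l0; rewrite -{1}(CodeSeq.decodeK l) nthc_code.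
case: (ltnP i (size (CodeSeq.decode l))) => sz; last by rewrite nth_default.
by apply: (allP (CodeSeq.gtn_decode l)); apply: mem_nth.
Qed.

(** * Correctness of the two tests on coded inputs *)

Section Decoding.

Variables (P : protocol) (S : composite_state).
Let c := code P S.

Lemma code_gt0 : 0 < c.
Proof. exact: leq_ltn_trans (consc_gtl _ _). Qed.

Lemma init_ofE j : init_of c j = nth 0 (init P) j.
Proof.
have E : c = code2 (code2 (code2 (pickle (nnodes P, edges P, msize P, nstates P))
  (CodeSeq.code (init P))) (pickle (trans P))) (pickle S).
  (* [pickle] is the identity on [nat], so pickling a list of numbers is [CodeSeq.code]. *)
  by rewrite -[in RHS](map_id (init P)).
by rewrite /init_of E !code2E !nthc_code.
Qed.

Lemma state_ofE j : state_of c j = nth 0 S j.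
Proof.
have E : c = code2 (pickle (enc_protocol P)) (CodeSeq.code S).
  by rewrite -[in RHS](map_id S).
by rewrite /state_of E code2E !nthc_code.
Qed.

Lemma trans_ofE j :
  trans_of c j = CodeSeq.code (map pickle (nth [::] (trans P) j)).
Proof.
have E : c = code2 (code2 (pickle (nnodes P, edges P, msize P, nstates P, init P))
  (CodeSeq.code (map (fun l => CodeSeq.code (map pickle l)) (trans P)))) (pickle S) by [].
rewrite /trans_of E !code2E !nthc_code.
case: (ltnP j (size (trans P))) => sz; first by rewrite (nth_map [::]).
by rewrite !nth_default ?size_map.
Qed.

Lemma init_of_ltn j : init_of c j < c.
Proof.
apply: leq_ltn_trans (nthc_ltn 0 code_gt0).
by do 3![apply: leq_trans (nthc_leq _ _) _].
Qed.

Lemma state_of_ltn j : state_of c j < c.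
Proof. exact: leq_ltn_trans (nthc_leq _ _) (nthc_ltn 1 code_gt0). Qed.

Lemma trans_of_ltn j : trans_of c j < c.
Proof.
apply: leq_ltn_trans (nthc_ltn 0 code_gt0).
by do 2![apply: leq_trans (nthc_leq _ _) _].
Qed.

Lemma trans_testE j p e b q : trans_test c j p e b q = trans_rel P j p e b q.
Proof.
have tcE (s : bool) : trans_code s p e b q = pickle (p, (s, e, b), q) by [].
rewrite /trans_test trans_ofE tcE /trans_rel; set T := nth [::] (trans P) j.
set t := (p, _, q); apply/ex_ltP/idP => [[i _]|tT].
  rewrite nthc_code => /eqP E; case: (ltnP i (size T)) => iT.
    rewrite (nth_map t) // in E.
    by have <- := pcan_inj pickleK E; apply: mem_nth.
  (* Past the end of the list [nthc] gives 0, which is not the code of a transition. *)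
  rewrite nth_default ?size_map // in E.
  by have := consc_gtr (code2 p (code2 (code2 (j == 0) e) b)) (consc q 0);
    rewrite -/(code2 _ _) -/(trans_code _ _ _ _ _) tcE -E.
exists (index t T); last first.
  by rewrite nthc_code (nth_map t) ?index_mem // nth_index.
apply: leq_ltn_trans (trans_of_ltn j); rewrite trans_ofE.
apply: leq_trans (size_code _); rewrite size_map.
by apply: ltnW; rewrite index_mem.
Qed.

Lemma trans_test_rel j : trans_test c j = trans_rel P j.
Proof.
by do 4![apply: functional_extensionality => ?]; apply: trans_testE.
Qed.

(** Well-formedness bounds the edge; the other components are smaller than the code of the
    transition, which is smaller than [c]. *)
Lemma trans_test_bounded j : wf P -> two_parallel_edges P -> j < 2 ->
  bounded c (trans_test c j).
Proof.
move=> wfP tpP j2 p e b q tj.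
have [_ _ e2 _ _] : [/\ _, _, e < 2, _ & _] := transP wfP tpP j2 (etrans (esym (trans_testE j p e b q)) tj).
have [i _ /eqP E] := ex_ltP _ _ tj.
have tc : trans_code (j == 0) p e b q < c.
  by rewrite -E; apply: leq_ltn_trans (nthc_leq _ _) (trans_of_ltn j).
have le2 x y : x < code2 x y /\ y < code2 x y.
  split; first exact: consc_gtl.
  exact: ltn_trans (consc_gtl _ _) (consc_gtr _ _).
move: tc; rewrite /trans_code.
set x1 := code2 (j == 0) e; set x2 := code2 x1 b; set x3 := code2 p x2 => tc.
have [? ?] := le2 x1 b; have [? ?] := le2 p x2; have [? ?] := le2 x3 q.
by split; lia.
Qed.

(** Being total, it lets every number be read as an element of a run, so no candidate is
    malformed. *)
Definition decode3 x := (nthc x 0, nthc x 1, nthc x 2).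

Lemma run_step_foldl j s (ok : bool) p x y :
  foldl (run_step c j) (code4 ok p (CodeSeq.code x) (CodeSeq.code y)) s =
  let s' := map decode3 s in
  code4 (ok && run (trans_rel P j) p s') (final p s')
    (CodeSeq.code (catrev (proj 0 s') x)) (CodeSeq.code (catrev (proj 1 s') y)).
Proof.
elim: s ok p x y => [|a s IH] ok p x y; first by rewrite /= andbT.
rewrite /foldl -/(foldl _ _ _) {2}/run_step.
have [-> -> -> ->] := nthc_code4 ok p (CodeSeq.code x) (CodeSeq.code y).
have -> : (nat_of_bool ok == 1) = ok by case: ok.
rewrite trans_testE !consc_code -!(fun_if CodeSeq.code) IH /= !proj_cons /= andbA.
by rewrite /final /=; congr (code4 _ _ (CodeSeq.code _) (CodeSeq.code _)); case: ifP.
Qed.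

Lemma run_codeE j s :
  let s' := map decode3 s in
  run_code c j (CodeSeq.code s) =
  code4 (run (trans_rel P j) (nth 0 (init P) j) s') (final (nth 0 (init P) j) s')
    (CodeSeq.code (rev (proj 0 s'))) (CodeSeq.code (rev (proj 1 s'))).
Proof.
rewrite /run_code foldc_code init_ofE.
exact: (run_step_foldl j s true _ [::] [::]).
Qed.

Lemma code_rev_inj : injective (fun s => CodeSeq.code (rev s)).
Proof. by move=> s s' /(can_inj CodeSeq.codeK) /(can_inj revK). Qed.

Lemma stable_testP w s r : nthc w 0 = CodeSeq.code s -> nthc w 1 = CodeSeq.code r ->
  let s' := map decode3 s in let r' := map decode3 r in
  let h0 := nth 0 (init P) 0 in let h1 := nth 0 (init P) 1 in
  stable_test c w <->
  [/\ run (trans_rel P 0) h0 s' && run (trans_rel P 1) h1 r',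
      final h0 s' = nth 0 S 0, final h1 r' = nth 0 S 1,
      proj 0 s' = proj 0 r' & proj 1 s' = proj 1 r'].
Proof.
move=> ws wr s' r' h0 h1; rewrite /stable_test ws wr !run_codeE !state_ofE.
rewrite -/s' -/r' -/h0 -/h1.
have [-> -> -> ->] := nthc_code4 (run (trans_rel P 0) h0 s') (final h0 s')
  (CodeSeq.code (rev (proj 0 s'))) (CodeSeq.code (rev (proj 1 s'))).
have [-> -> -> ->] := nthc_code4 (run (trans_rel P 1) h1 r') (final h1 r')
  (CodeSeq.code (rev (proj 0 r'))) (CodeSeq.code (rev (proj 1 r'))).
rewrite !(inj_eq code_rev_inj) !eqb1; split.
  by case/and5P=> -> -> /eqP-> /eqP-> /andP[/eqP-> /eqP->].
by case=> /andP[-> ->] -> -> -> ->; rewrite !eqxx.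
Qed.

Hypotheses (wfP : wf P) (tpP : two_parallel_edges P) (vS : valid_cs P S).

Lemma valid_cs2 : S = [:: nth 0 S 0; nth 0 S 1].
Proof. by apply: seq2E; case: vS => -> _; case: tpP. Qed.

Lemma stable_test_correct : stable P S <-> exists w, stable_test c w.
Proof.
rewrite {1}valid_cs2 (stable_runs wfP tpP); split.
  move=> [s [r H]].
  pose enc (x : nat * nat * nat) := CodeSeq.code [:: x.1.1; x.1.2; x.2].
  have encK : cancel enc decode3 by case=> [[a b] d]; rewrite /decode3 !nthc_code.
  pose w := CodeSeq.code [:: CodeSeq.code (map enc s); CodeSeq.code (map enc r)].
  exists w; apply/(@stable_testP w (map enc s) (map enc r)); rewrite ?nthc_code //.
  by rewrite !(mapK encK).
(* Every number codes a list, so the entries of an arbitrary [w] do yield runs. *)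
move=> [w]; move/(@stable_testP w _ _ (esym (CodeSeq.decodeK _)) (esym (CodeSeq.decodeK _))).
by move=> H; do 2!eexists; exact: H.
Qed.

Lemma unstable_test_sound w : unstable_test c w -> ~ stable P S.
Proof.
move=> cert; rewrite valid_cs2 (stable_runs wfP tpP) => -[s [r [/andP[rs rr] fs fr p0 p1]]].
move: cert; rewrite /unstable_test !state_ofE => cert.
rewrite -!init_ofE -!trans_test_rel in rs rr fs fr.
have B0 : bounded c (trans_test c 0) by apply: trans_test_bounded.
have B1 : bounded c (trans_test c 1) by apply: trans_test_bounded.
exact: (certificate_sound B0 B1 (init_of_ltn 0) (init_of_ltn 1) cert rs rr fs fr p0 p1).
Qed.

Lemma unstable_test_complete : rational_channel_property P -> ~ stable P S ->
  exists w, unstable_test c w.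
Proof.
move=> rcp; rewrite {1}valid_cs2 => nst.
have [||||N [u [rho [lam [acc cert]]]]] :=
  @certificate_complete P c _ _ wfP tpP rcp _ _ _ _ nst.
- by rewrite -init_ofE init_of_ltn.
- by rewrite -init_ofE init_of_ltn.
- by rewrite -state_ofE state_of_ltn.
- by rewrite -state_ofE state_of_ltn.
(* The tables are indexed by codes of argument tuples; their values matter only on the finite ranges
   below [N], [c] and 2. *)
have [Rho RhoE] := table_exists (fun i => rho (nthc i 0) (nthc i 1))
  [seq code2 m a | m <- iota 0 N, a <- iota 0 c].
have [Lam LamE] := table_exists (fun i => lam (nthc i 0) (nthc i 1))
  [seq code2 a m | m <- iota 0 N, a <- iota 0 c].
have [Acc AccE] := table_exists (fun i => acc (nthc i 0) (nthc i 1) (nthc i 2) (nthc i 3))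
  [seq code4 x.1 x.2 y.1 y.2 | x <- [seq (e, m) | e <- iota 0 2, m <- iota 0 N],
                               y <- [seq (p, q) | p <- iota 0 c, q <- iota 0 c]].
exists (CodeSeq.code [:: N; u; Rho; Lam; Acc]).
rewrite /unstable_test !nthc_code !init_ofE !state_ofE !trans_test_rel.
apply: cert.
- move=> m a mN ac; rewrite RhoE ?code2E ?nthc_code //.
  by apply/allpairsPdep; exists m, a; rewrite !mem_iota.
- move=> m a mN ac; rewrite LamE ?code2E ?nthc_code //.
  by apply/allpairsPdep; exists m, a; rewrite !mem_iota.
- move=> e m p q e2 mN pc qc; rewrite AccE; last first.
    apply/allpairsPdep; exists (e, m), (p, q).
    by split=> //; apply/allpairsPdep; [exists e, m | exists p, q]; rewrite !mem_iota.
  by have [-> -> -> ->] := nthc_code4 e m p q; case: (acc _ _ _ _).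
Qed.

End Decoding.

Theorem theorem10p3 :
  exists prog : seq rm_instr,
    forall (P : protocol) (S : composite_state),
      wf P -> two_parallel_edges P -> rational_channel_property P -> valid_cs P S ->
      (stable P S -> rm_computes prog (code P S) 1) /\
      (~ stable P S -> rm_computes prog (code P S) 0).
Proof.
pose found c n := stable_test c n || unstable_test c n.
have [||prog progP] := @rm_search found (fun c n => stable_test c n).
- apply: pr_negb; apply: pr_orb; [apply: pr_stable_test | apply: pr_unstable_test]; pr.
- by apply: pr_stable_test; pr.
exists prog => P S wfP tpP rcp vS.
have search : (exists n, found (code P S) n) -> exists n,
    found (code P S) n /\ rm_computes prog (code P S) (stable_test (code P S) n).
  move=> ex; have [n fn min_n] := ex_minnP ex.
  exists n; split=> //; apply: progP => // m mn.
  by apply/negP => /min_n; rewrite leqNgt mn.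
(* Completeness of one test makes the search stop. The first hit may differ from the evidence known
   to exist, but soundness of the tests fixes the answer. *)
split=> st.
  have [w stw] := (stable_test_correct wfP tpP vS).1 st.
  have [|n [fn]] := search; first by exists w; rewrite /found stw.
  case/orP: fn => [-> //|un].
  by case: (unstable_test_sound wfP tpP vS un st).
have [w unw] := unstable_test_complete wfP tpP vS rcp st.
have [|n [fn]] := search; first by exists w; rewrite /found unw orbT.
case: (boolP (stable_test (code P S) n)) => // stn _.
by case: st; apply/(stable_test_correct wfP tpP vS); exists n.
Qed.
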